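(* Let $0<b<1$, $\omega\in\mathbb{R}$, let $l\in\mathbb{N}$ and $m\in\{-l,\dots,l\}\setminus\{0\}$, let $\lambda_{l,m}$ be the corresponding eigenvalue of $-\Delta$ on the ellipsoid $\mathbb{S}^2$, and let $Y_l^m\in\mathbb{E}_{l,m}$. Then there exists a function $g\in C^{3,\alpha}\left(\left(-\frac{\pi}{2},\frac{\pi}{2}\right)\right)$ solving the ODE \[ -\lambda_{l,m}\, g(\theta)=\frac{1}{\cos\theta\,\rho(\theta)}\left(\frac{\cos\theta}{\rho(\theta)}\,g'(\theta)\right)'+\frac{2\omega\sin\theta}{\rho(\theta)},\qquad \theta\in\left(-\tfrac{\pi}{2},\tfrac{\pi}{2}\right), \] together with the boundary conditions $\lim_{\theta\to\pm\frac{\pi}{2}} g'(\theta)=0$. Consequently, $\psi(\varphi,\theta)=g(\theta)+Y_l^m(\varphi,\theta)$ solves the stationary Euler equations \[ \left[-\partial_\theta\psi\,\partial_\varphi+\partial_\varphi\psi\,\partial_\theta\right]\left(\Delta\psi+\frac{2\omega\sin\theta}{\rho(\theta)}\right)=0 . \]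
   Context: The surface $\mathbb{S}^2$ denotes the biaxial ellipsoid with major axis $1$ and minor axis $b\in(0,1)$, parametrized by $(\varphi,\theta)\in[-\pi,\pi)\times[-\frac{\pi}{2},\frac{\pi}{2}]\mapsto(\cos\varphi\cos\theta,\sin\varphi\cos\theta,b\sin\theta)$; functions are $2\pi$-periodic in $\varphi$. Write $\rho(\theta)=\sqrt{\sin^2\theta+b^2\cos^2\theta}$. The Riemannian area element is $d\sigma=\cos\theta\,\rho(\theta)\,d\varphi\,d\theta$, and the Laplace–Beltrami operator is $\Delta\psi=\frac{1}{\cos^2\theta}\partial_{\varphi\varphi}\psi+\frac{1}{\cos\theta\,\rho(\theta)}\partial_\theta\!\left(\frac{\cos\theta}{\rho(\theta)}\partial_\theta\psi\right)$. For $l\in\mathbb{N}$ and $m\in\{-l,\dots,l\}$, $\mathbb{E}_{l,m}$ denotes the $(l,m)$-th eigenspace of $-\Delta$ on $\mathbb{S}^2$ with eigenvalue $\lambda_{l,m}$ (labelled so that as $b\to1$, $\lambda_{l,m}\to l(l+1)$); for $m\neq0$ it is assumed that $\mathbb{E}_{l,m}$ has an $L^2(\mathbb{S}^2,d\sigma)$-orthonormal basis of the form $\{y_1(\theta)e^{im\varphi},\,y_2(\theta)e^{-im\varphi}\}$ with smooth $y_1,y_2$. $C^{3,\alpha}$ denotes the Hölder space with some exponent $\alpha\in(0,1)$. *)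

(* Defs.v *)
From Stdlib Require Import Reals List.
From Coquelicot Require Import Coquelicot.
Open Scope R_scope.

Definition rho (b th : R) : R := sqrt (sin th ^ 2 + b ^ 2 * cos th ^ 2).

Definition partial3 (i : nat) (F : R -> R -> R -> R) : R -> R -> R -> R :=
  match i with
  | O => fun x y z => Derive (fun t => F t y z) x
  | S O => fun x y z => Derive (fun t => F x t z) y
  | _ => fun x y z => Derive (fun t => F x y t) z
  end.

Definition ex_partial3 (i : nat) (F : R -> R -> R -> R) (x y z : R) : Prop :=
  match i with
  | O => ex_derive (fun t => F t y z) x
  | S O => ex_derive (fun t => F x t z) y
  | _ => ex_derive (fun t => F x y t) z
  end.

Definition iter_partial3 (l : list nat) (F : R -> R -> R -> R) : R -> R -> R -> R :=
  fold_right partial3 F l.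

Definition smooth3 (F : R -> R -> R -> R) : Prop :=
  forall l : list nat,
    (forall p : R * R * R,
        continuous (fun q : R * R * R =>
          iter_partial3 l F (fst (fst q)) (snd (fst q)) (snd q)) p) /\
    (forall (i : nat) (x y z : R), ex_partial3 i (iter_partial3 l F) x y z).

(* psi is (the coordinate expression of) a smooth function on the ellipsoid:
   it is the restriction of a smooth function on R^3 to the ellipsoid
   (phi, theta) |-> (cos phi cos theta, sin phi cos theta, b sin theta),
   theta in [-pi/2, pi/2], phi arbitrary (hence 2pi-periodic). *)
Definition smooth_on_ellipsoid (b : R) (psi : R -> R -> C) : Prop :=
  exists Fr Fi : R -> R -> R -> R,
    smooth3 Fr /\ smooth3 Fi /\
    forall phi th, - (PI / 2) <= th <= PI / 2 ->
      psi phi th =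
        (Fr (cos phi * cos th) (sin phi * cos th) (b * sin th),
         Fi (cos phi * cos th) (sin phi * cos th) (b * sin th)).

Definition dphi (u : R -> R -> R) : R -> R -> R :=
  fun phi th => Derive (fun t => u t th) phi.
Definition dth (u : R -> R -> R) : R -> R -> R :=
  fun phi th => Derive (fun t => u phi t) th.

Definition LapR (b : R) (u : R -> R -> R) : R -> R -> R :=
  fun phi th =>
    / (cos th ^ 2) * dphi (dphi u) phi th
    + / (cos th * rho b th) *
        dth (fun p t => cos t / rho b t * dth u p t) phi th.

Definition ReF (psi : R -> R -> C) : R -> R -> R := fun p t => Re (psi p t).
Definition ImF (psi : R -> R -> C) : R -> R -> R := fun p t => Im (psi p t).
Definition dphiC (psi : R -> R -> C) : R -> R -> C :=
  fun p t => (dphi (ReF psi) p t, dphi (ImF psi) p t).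
Definition dthC (psi : R -> R -> C) : R -> R -> C :=
  fun p t => (dth (ReF psi) p t, dth (ImF psi) p t).
Definition LapC (b : R) (psi : R -> R -> C) : R -> R -> C :=
  fun p t => (LapR b (ReF psi) p t, LapR b (ImF psi) p t).

Definition in_eigenspace (b lam : R) (psi : R -> R -> C) : Prop :=
  smooth_on_ellipsoid b psi /\
  forall phi th, - (PI / 2) < th < PI / 2 ->
    Cmult (RtoC (- 1)) (LapC b psi phi th) = Cmult (RtoC lam) (psi phi th).

(* L^2(S^2, d sigma) inner product  <e, f> = int e * conj f  d sigma,
   d sigma = cos theta rho(theta) d phi d theta *)
Definition L2inner (b : R) (e f : R -> R -> C) : C :=
  (RInt (fun th => RInt (fun phi =>
      (Re (e phi th) * Re (f phi th) + Im (e phi th) * Im (f phi th))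
        * cos th * rho b th) (- PI) PI) (- (PI / 2)) (PI / 2),
   RInt (fun th => RInt (fun phi =>
      (Im (e phi th) * Re (f phi th) - Re (e phi th) * Im (f phi th))
        * cos th * rho b th) (- PI) PI) (- (PI / 2)) (PI / 2)).

Definition mode (m : Z) (y : R -> C) : R -> R -> C :=
  fun phi th => Cmult (y th) (cos (IZR m * phi), sin (IZR m * phi)).

Definition eigenspace_has_basis (b lam : R) (m : Z) (y1 y2 : R -> C) : Prop :=
  (forall psi : R -> R -> C,
     in_eigenspace b lam psi <->
     exists c1 c2 : C, forall phi th, - (PI / 2) <= th <= PI / 2 ->
       psi phi th = Cplus (Cmult c1 (mode m y1 phi th))
                          (Cmult c2 (mode (- m) y2 phi th))) /\
  L2inner b (mode m y1) (mode m y1) = RtoC 1 /\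
  L2inner b (mode (- m) y2) (mode (- m) y2) = RtoC 1 /\
  L2inner b (mode m y1) (mode (- m) y2) = RtoC 0.

Definition C3alpha (alpha a c : R) (g : R -> R) : Prop :=
  (forall x, a < x < c ->
     ex_derive g x /\ ex_derive (Derive g) x /\ ex_derive (Derive_n g 2) x) /\
  (forall a' c', a < a' -> c' < c ->
     exists K : R, forall x y, a' <= x -> x < y -> y <= c' ->
       Rabs (Derive_n g 3 x - Derive_n g 3 y) <= K * Rpower (y - x) alpha).

Definition euler_op (b omega : R) (psi : R -> R -> C) : R -> R -> C :=
  let W := fun p t => Cplus (LapC b psi p t)
                            (RtoC (2 * omega * sin t / rho b t)) in
  fun p t =>
    Cplus (Cmult (Copp (dthC psi p t)) (dphiC W p t))
          (Cmult (dphiC psi p t) (dthC W p t)).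

(* Main.v *)
Require Import Defs.
From Stdlib Require Import Reals List ZArith.
From Stdlib Require Import Lra Lia FunctionalExtensionality.
From Coquelicot Require Import Coquelicot.
Open Scope R_scope.

(* In the variable s = sin theta, the axisymmetric equation is a Sturm-Liouville
   equation on (-1, 1) with regular singular points at the poles s = -1, 1 and
   an odd source.  It has a one-parameter family P + c H of solutions that are
   regular at s = 1, where H is the homogeneous one with H(1) = 1.  A solution
   regular at s = 1 and vanishing at s = 0 is odd, hence regular at both poles.
   Such a member of the family exists as soon as H(0) <> 0.  If H(0) = 0, then H
   itself is odd and is a nonzero axisymmetric function of the eigenspace,
   which a basis of modes exp(i m phi), exp(- i m phi) with m <> 0 excludes.
   For psi = g + Y the absolute vorticity is then -lam psi, so its Jacobian with
   psi vanishes. *)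

(** The obstacle is resonance: if [lam] has an odd axisymmetric eigenfunction, the odd source may be
    incompatible with regularity at both poles. An even one is harmless, so the value of [H] at the
    equator is the right test. Oddness replaces a matching argument at the second pole: reflection
    copies the regularity already obtained at the first. At s = 1 the equation, integrated once,
    becomes a fixed-point problem whose unknown enters only through its means over [1, s]. Its
    coefficients are continuous for s > -1, and the iteration converges for every [lam] because each
    step gains a factor |s - 1| / (n + 1). Smoothness is sought in s up to and across the poles, not
    merely in theta: then g' = cos theta G'(sin theta) makes both boundary conditions automatic. A
    second difficulty is [Y]: its smoothness is given by iterated partial derivatives of an
    extension to R^3, so a chain rule in three variables is needed before the Laplacian of g + Y can
    be split. *)

(** * Differentiability classes on an open set *)

(* [ring] and [field] do not recognise equalities typed in a Coquelicot structure. *)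
Ltac eq_in_R := match goal with |- @eq _ ?x ?y => change (@eq R x y) end.

Fixpoint Ck (D : R -> Prop) (n : nat) (f : R -> R) : Prop :=
  match n with
  | O => forall x, D x -> continuous f x
  | S n => (forall x, D x -> ex_derive f x) /\ Ck D n (Derive f)
  end.

Definition smooth (D : R -> Prop) (f : R -> R) : Prop := forall n, Ck D n f.

Definition everywhere (x : R) : Prop := True.

Lemma open_everywhere : open everywhere.
Proof. intros x _. exists (mkposreal 1 Rlt_0_1). intros; exact I. Qed.

(** Openness of [D] is what makes this true: equality on [D] is then equality near each of its
    points, which is what [Derive] sees. *)
Lemma Ck_ext (D : R -> Prop) (n : nat) (f g : R -> R) :
  open D -> (forall x, D x -> f x = g x) -> Ck D n f -> Ck D n g.
Proof.
  intros HD; revert f g; induction n as [|n IH]; simpl; intros f g H Hf.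
  - intros x Hx. apply continuous_ext_loc with f; [|now apply Hf].
    apply filter_imp with D; [|now apply HD]. intros y Hy; apply H, Hy.
  - assert (L : forall x, D x -> locally x (fun y => f y = g y)).
    { intros x Hx. apply filter_imp with D; [|now apply HD]. intros y Hy; apply H, Hy. }
    destruct Hf as [Hf1 Hf2]; split.
    + intros x Hx. apply ex_derive_ext_loc with f; [now apply L | now apply Hf1].
    + apply IH with (Derive f); [|exact Hf2].
      intros x Hx. apply Derive_ext_loc, L, Hx.
Qed.

Lemma Ck_intro (D : R -> Prop) (n : nat) (f df : R -> R) :
  open D -> (forall x, D x -> is_derive f x (df x)) -> Ck D n df -> Ck D (S n) f.
Proof.
  intros HD H Hd; split.
  - intros x Hx; exists (df x); now apply H.
  - apply Ck_ext with df; auto. intros x Hx; symmetry; now apply is_derive_unique, H.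
Qed.

Lemma Ck_continuous (D : R -> Prop) (n : nat) (f : R -> R) (x : R) :
  Ck D n f -> D x -> continuous f x.
Proof.
  destruct n; simpl; intros H Hx; [now apply H|].
  apply @ex_derive_continuous, H, Hx.
Qed.

Lemma Ck_pred (D : R -> Prop) (n : nat) (f : R -> R) : Ck D (S n) f -> Ck D n f.
Proof.
  revert f; induction n; intros f H.
  - intros x Hx; now apply (Ck_continuous D 1).
  - destruct H as [H1 H2]; split; auto.
Qed.

(** Used to glue the odd solution from one formula near each pole. *)
Lemma Ck_cover (D1 D2 D : R -> Prop) (n : nat) (f : R -> R) :
  (forall x, D x -> D1 x \/ D2 x) -> Ck D1 n f -> Ck D2 n f -> Ck D n f.
Proof.
  intros H; revert f; induction n; simpl; intros f.
  - intros H1 H2 x Hx; destruct (H x Hx); auto.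
  - intros [H1 H1'] [H2 H2']; split; auto.
    intros x Hx; destruct (H x Hx); auto.
Qed.

Lemma Ck_const (D : R -> Prop) (n : nat) (c : R) : Ck D n (fun _ => c).
Proof.
  revert c; induction n; intros c.
  - intros x _; apply continuous_const.
  - split; [intros; apply ex_derive_const|].
    replace (Derive (fun _ => c)) with (fun _ : R => 0); [apply IHn|].
    apply functional_extensionality; intros x.
    now rewrite Derive_const.
Qed.

Lemma Ck_id (D : R -> Prop) (n : nat) : open D -> Ck D n (fun x => x).
Proof.
  intros HD; destruct n.
  - intros x _; apply continuous_id.
  - apply Ck_intro with (fun _ => 1); auto using Ck_const.
    intros; apply @is_derive_id.
Qed.

Lemma Ck_plus (D : R -> Prop) (n : nat) (f g : R -> R) :
  open D -> Ck D n f -> Ck D n g -> Ck D n (fun x => f x + g x).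
Proof.
  intros HD; revert f g; induction n; intros f g Hf Hg.
  - intros x Hx; apply (continuous_plus f g); auto.
  - destruct Hf as [Hf Hf'], Hg as [Hg Hg'].
    apply Ck_intro with (fun x => Derive f x + Derive g x); auto.
    intros x Hx; apply (is_derive_plus f g); apply Derive_correct; auto.
Qed.

Lemma Ck_mult (D : R -> Prop) (n : nat) (f g : R -> R) :
  open D -> Ck D n f -> Ck D n g -> Ck D n (fun x => f x * g x).
Proof.
  intros HD; revert f g; induction n; intros f g Hf Hg.
  - intros x Hx; apply (continuous_mult f g); auto.
  - pose proof (Ck_pred _ _ _ Hf); pose proof (Ck_pred _ _ _ Hg).
    destruct Hf as [Hf Hf'], Hg as [Hg Hg'].
    apply Ck_intro with (fun x => Derive f x * g x + f x * Derive g x); auto.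
    + intros x Hx. apply (is_derive_mult f g);
        try (apply Derive_correct; auto). intros; apply Rmult_comm.
    + apply Ck_plus; auto.
Qed.

Lemma Ck_comp (D D' : R -> Prop) (n : nat) (f g : R -> R) :
  open D -> (forall x, D x -> D' (g x)) ->
  Ck D' n f -> Ck D n g -> Ck D n (fun x => f (g x)).
Proof.
  intros HD HDD; revert f g HDD; induction n; intros f g HDD Hf Hg.
  - intros x Hx; apply continuous_comp; auto.
  - pose proof (Ck_pred _ _ _ Hg).
    destruct Hf as [Hf Hf'], Hg as [Hg Hg'].
    apply Ck_intro with (fun x => Derive g x * Derive f (g x)); auto.
    + intros x Hx. apply (is_derive_comp f g); apply Derive_correct; auto.
    + apply Ck_mult; auto.
Qed.

Lemma Ck_inv (D : R -> Prop) (n : nat) (f : R -> R) :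
  open D -> (forall x, D x -> f x <> 0) -> Ck D n f -> Ck D n (fun x => / f x).
Proof.
  intros HD Hnz; revert f Hnz; induction n; intros f Hnz Hf.
  - intros x Hx; apply (continuous_comp f Rinv); auto.
    apply continuous_Rinv; auto.
  - pose proof (Ck_pred _ _ _ Hf). destruct Hf as [Hf Hf'].
    apply Ck_intro with (fun x => - 1 * (Derive f x * (/ f x * / f x))); auto.
    + intros x Hx. evar_last; [apply is_derive_inv; [apply Derive_correct|]; auto|].
      field; auto.
    + repeat apply Ck_mult; auto using Ck_const.
Qed.

Lemma Ck_sqrt (D : R -> Prop) (n : nat) (f : R -> R) :
  open D -> (forall x, D x -> 0 < f x) -> Ck D n f -> Ck D n (fun x => sqrt (f x)).
Proof.
  intros HD Hp; revert f Hp; induction n; intros f Hp Hf.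
  - intros x Hx; apply (continuous_comp f sqrt); auto. apply continuous_sqrt.
  - pose proof (Ck_pred _ _ _ Hf). destruct Hf as [Hf Hf'].
    apply Ck_intro with (fun x => Derive f x * / (2 * sqrt (f x))); auto.
    + intros x Hx. evar_last; [apply is_derive_sqrt; [apply Derive_correct|]; auto|].
      reflexivity.
    + apply Ck_mult, Ck_inv; auto.
      * intros x Hx. specialize (Hp x Hx). apply sqrt_lt_R0 in Hp; lra.
      * apply Ck_mult; auto using Ck_const.
Qed.

Lemma Ck_sin_cos (n : nat) : Ck everywhere n sin /\ Ck everywhere n cos.
Proof.
  induction n as [|n [IH1 IH2]].
  - split; intros x _; [apply continuous_sin | apply continuous_cos].
  - split.
    + apply Ck_intro with cos; auto using open_everywhere.
      intros; apply is_derive_sin.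
    + apply Ck_intro with (fun x => -1 * sin x); auto using open_everywhere.
      * intros x _; evar_last; [apply is_derive_cos | ring].
      * apply Ck_mult; auto using open_everywhere, Ck_const.
Qed.

Lemma smooth_Derive (D : R -> Prop) (f : R -> R) : smooth D f -> smooth D (Derive f).
Proof. intros H n; apply (H (S n)). Qed.

Lemma smooth_ex_derive (D : R -> Prop) (f : R -> R) (x : R) :
  smooth D f -> D x -> ex_derive f x.
Proof. intros H Hx; now apply (H 1%nat). Qed.

(** * Means over the segment joining 1 to s *)

Lemma continuous_RInt_param (f : R -> R -> R) (a b x : R) :
  a <= b ->
  (forall t, a <= t <= b -> continuity_2d_pt f x t) ->
  locally x (fun y => ex_RInt (f y) a b) ->
  continuous (fun y => RInt (f y) a b) x.
Proof.
  intros Hab Hf Hex.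
  apply continuity_pt_filterlim, continuity_pt_locally; intros eps.
  (* The summand 1 keeps the denominator positive when a = b. *)
  assert (Hd : 0 < eps / (2 * (b - a + 1))).
  { apply Rdiv_lt_0_compat; [apply cond_pos | lra]. }
  destruct (uniform_continuity_2d_1d' f a b x Hf (mkposreal _ Hd)) as [d H].
  generalize (locally_ball x d); intros Hb.
  generalize (filter_and _ _ Hex Hb); apply filter_imp.
  intros y [Hy Hyb].
  assert (Ex : ex_RInt (f x) a b) by now apply locally_singleton in Hex.
  change (RInt (f y) a b - RInt (f x) a b) with (minus (RInt (f y) a b) (RInt (f x) a b)).
  rewrite <- RInt_minus by assumption.
  apply Rle_lt_trans with ((b - a) * (eps / (2 * (b - a + 1)))).
  - apply abs_RInt_le_const; auto.
    + apply @ex_RInt_minus; assumption.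
    + intros t Ht. left. change (Rabs (y - x) < d) in Hyb. apply Rabs_lt_between' in Hyb. pose proof (cond_pos d).
      apply (H t x t y); auto; try lra.
      replace (t - t) with 0 by ring; now rewrite Rabs_R0.
  - assert (0 < eps) by apply cond_pos.
    replace ((b - a) * (eps / (2 * (b - a + 1)))) with
      (eps - eps * ((b - a + 2) / (2 * (b - a + 1)))) by (field; lra).
    assert (0 < (b - a + 2) / (2 * (b - a + 1))) by (apply Rdiv_lt_0_compat; lra).
    nra.
Qed.

(** Star-shaped about s = 1, the north pole, which is the base point of all the means below. *)
Definition starlike (D : R -> Prop) : Prop :=
  forall s u, D s -> 0 <= u <= 1 -> D (1 + u * (s - 1)).

Lemma starlike_segment (D : R -> Prop) (s z : R) :
  starlike D -> D s -> Rmin 1 s <= z <= Rmax 1 s -> D z.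
Proof.
  intros HD Hs Hz. destruct (Req_dec s 1) as [->|Hn].
  - rewrite Rmin_left, Rmax_left in Hz by lra. now replace z with 1 by lra.
  - replace z with (1 + ((z - 1) / (s - 1)) * (s - 1)) by (field; lra).
    apply HD; auto. destruct (Rlt_le_dec s 1).
    + rewrite Rmin_right, Rmax_left in Hz by lra.
      replace ((z - 1) / (s - 1)) with ((1 - z) / (1 - s)) by (field; lra).
      split; [apply Rdiv_le_0_compat; lra | apply -> Rdiv_le_1; lra].
    + assert (1 < s) by (destruct (Rle_lt_or_eq_dec 1 s); auto; now subst).
      rewrite Rmin_left, Rmax_right in Hz by lra.
      split; [apply Rdiv_le_0_compat; lra | apply -> Rdiv_le_1; lra].
Qed.

(* For [k = 0] this is the mean value of [F] between [1] and [s]; the moments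
   [k > 0] make the family stable under differentiation. *)
Definition avg (k : nat) (F : R -> R) (s : R) : R :=
  RInt (fun u => u ^ k * F (1 + u * (s - 1))) 0 1.

Lemma continuity_2d_avg (k : nat) (F : R -> R) (s u : R) :
  continuous F (1 + u * (s - 1)) ->
  continuity_2d_pt (fun s u => u ^ k * F (1 + u * (s - 1))) s u.
Proof.
  intros H. apply continuity_2d_pt_mult.
  - apply (continuity_1d_2d_pt_comp (fun u => u ^ k) (fun _ u => u)).
    + apply derivable_continuous_pt, derivable_pt_pow.
    + apply continuity_2d_pt_id2.
  - apply (continuity_1d_2d_pt_comp F (fun s u => 1 + u * (s - 1))).
    + now apply continuity_pt_filterlim.
    + apply continuity_2d_pt_plus; [apply continuity_2d_pt_const|].
      apply continuity_2d_pt_mult; [apply continuity_2d_pt_id2|].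
      apply continuity_2d_pt_minus; [apply continuity_2d_pt_id1 | apply continuity_2d_pt_const].
Qed.

Lemma ex_RInt_avg (D : R -> Prop) (k : nat) (F : R -> R) (s : R) :
  starlike D -> (forall x, D x -> continuous F x) -> D s ->
  ex_RInt (fun u => u ^ k * F (1 + u * (s - 1))) 0 1.
Proof.
  intros HD HF Hs. apply @ex_RInt_continuous.
  rewrite Rmin_left, Rmax_right by lra. intros u Hu.
  apply (continuous_mult (fun u => u ^ k) (fun u => F (1 + u * (s - 1)))).
  - apply continuity_pt_filterlim, derivable_continuous_pt, derivable_pt_pow.
  - apply (continuous_comp (fun u => 1 + u * (s - 1)) F).
    + apply @ex_derive_continuous; auto_derive; auto.
    + apply HF, HD; auto.
Qed.

Lemma continuous_avg (D : R -> Prop) (k : nat) (F : R -> R) (s : R) :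
  open D -> starlike D -> (forall x, D x -> continuous F x) -> D s ->
  continuous (avg k F) s.
Proof.
  intros HO HD HF Hs. apply continuous_RInt_param; [lra| |].
  - intros u Hu; apply continuity_2d_avg, HF, HD; auto.
  - apply filter_imp with D; [|now apply HO]. intros; eapply ex_RInt_avg; eauto.
Qed.

(** Differentiation under the integral sign; the chain rule brings out a factor u, which raises the
    moment by one. *)
Lemma is_derive_avg (D : R -> Prop) (k : nat) (F : R -> R) (s : R) :
  open D -> starlike D -> Ck D 1 F -> D s ->
  is_derive (avg k F) s (avg (S k) (Derive F) s).
Proof.
  intros HO HD [H1 H2] Hs.
  assert (HdF : forall x u, D (1 + u * (x - 1)) ->
    is_derive (fun z => u ^ k * F (1 + u * (z - 1))) x
      (u ^ S k * Derive F (1 + u * (x - 1)))).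
  { intros x u Hx. specialize (H1 _ Hx).
    auto_derive; auto. simpl. unfold Rminus.
    change (fun x0 => F x0) with F. ring. }
  evar_last.
  - apply is_derive_RInt_param; rewrite ?Rmin_left, ?Rmax_right by lra.
    + apply filter_imp with D; [|now apply HO].
      intros x Hx u Hu. eexists; now apply HdF, HD.
    + intros u Hu. destruct (HO _ (HD _ _ Hs Hu)) as [e He].
      apply continuity_2d_pt_ext_loc with (fun x v => v ^ S k * Derive F (1 + v * (x - 1))).
      * assert (C : continuity_2d_pt (fun x v => 1 + v * (x - 1)) s u).
        { apply continuity_2d_pt_plus; [apply continuity_2d_pt_const|].
          apply continuity_2d_pt_mult; [apply continuity_2d_pt_id2|].
          apply continuity_2d_pt_minus;
            [apply continuity_2d_pt_id1 | apply continuity_2d_pt_const]. }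
        destruct (C e) as [d Hd]. exists d. intros x v Hx Hv.
        symmetry; apply is_derive_unique, HdF, He, Hd; auto.
      * apply continuity_2d_avg, H2, HD; auto.
    + apply filter_imp with D; [|now apply HO].
      intros; eapply ex_RInt_avg; eauto. intros; now apply (Ck_continuous D 1).
  - apply RInt_ext. rewrite Rmin_left, Rmax_right by lra. intros u Hu.
    apply is_derive_unique, HdF, HD; auto; lra.
Qed.

Lemma Ck_avg (D : R -> Prop) (n k : nat) (F : R -> R) :
  open D -> starlike D -> Ck D n F -> Ck D n (avg k F).
Proof.
  intros HO HD; revert k F; induction n; intros k F H.
  - intros x Hx; now apply continuous_avg with D.
  - apply Ck_intro with (avg (S k) (Derive F)); auto.
    + intros x Hx; apply is_derive_avg with D; auto.
      destruct H as [H1 H2]; split; auto. intros y Hy; now apply (Ck_continuous D n).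
    + now apply IHn, H.
Qed.

Lemma avg_ext (k : nat) (F G : R -> R) (D : R -> Prop) (s : R) :
  starlike D -> D s -> (forall x, D x -> F x = G x) -> avg k F s = avg k G s.
Proof.
  intros HD Hs H; apply RInt_ext; rewrite Rmin_left, Rmax_right by lra.
  intros u Hu. rewrite H; auto. apply HD; auto; lra.
Qed.

Lemma avg_at_1 (F : R -> R) : avg 0 F 1 = F 1.
Proof.
  unfold avg. rewrite (RInt_ext _ (fun _ => F 1)).
  - rewrite RInt_const. unfold scal; simpl; unfold mult; simpl. ring.
  - intros u _. simpl. replace (1 + u * (1 - 1)) with 1 by ring. ring.
Qed.

(** The substitution t = 1 + u (s - 1). The product form avoids dividing by s - 1 at the pole. *)
Lemma avg_RInt (D : R -> Prop) (F : R -> R) (s : R) :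
  starlike D -> (forall x, D x -> continuous F x) -> D s ->
  (s - 1) * avg 0 F s = RInt F 1 s.
Proof.
  intros HD HF Hs. unfold avg.
  change ((s - 1) * RInt (fun u => u ^ 0 * F (1 + u * (s - 1))) 0 1)
    with (scal (s - 1) (RInt (fun u => u ^ 0 * F (1 + u * (s - 1))) 0 1)).
  rewrite <- RInt_scal by now apply (ex_RInt_avg D 0).
  rewrite (RInt_ext _ (fun u => scal (s - 1) (F ((s - 1) * u + 1)))).
  - etransitivity; [apply (RInt_comp_lin F (s - 1) 1 0 1)|f_equal; ring].
    replace ((s - 1) * 0 + 1) with 1 by ring. replace ((s - 1) * 1 + 1) with s by ring.
    apply @ex_RInt_continuous. intros z Hz. now apply HF, (starlike_segment D s).
  - intros u _. unfold scal; simpl; unfold mult; simpl.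
    replace (1 + u * (s - 1)) with ((s - 1) * u + 1) by ring. ring.
Qed.

Lemma avg_lin (D : R -> Prop) (F G : R -> R) (c s : R) :
  starlike D -> (forall x, D x -> continuous F x) ->
  (forall x, D x -> continuous G x) -> D s ->
  avg 0 (fun x => F x + c * G x) s = avg 0 F s + c * avg 0 G s.
Proof.
  intros HD HF HG Hs. unfold avg.
  pose proof (ex_RInt_avg D 0 F s HD HF Hs). pose proof (ex_RInt_avg D 0 G s HD HG Hs).
  change (c * ?x) with (scal c x). rewrite <- RInt_scal by assumption.
  change (?x + ?y) with (plus x y). rewrite <- RInt_plus; auto.
  - apply RInt_ext; intros u _. unfold scal, plus; simpl; unfold mult; simpl. ring.
  - now apply @ex_RInt_scal.
Qed.

(** The divisor n + 1 is the integral of u^n over [0, 1]; iterated, it produces the factorial in the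
    Picard estimate. *)
Lemma avg_bound (D : R -> Prop) (F : R -> R) (C : R) (n : nat) (s : R) :
  starlike D -> (forall x, D x -> continuous F x) -> D s ->
  (forall x, D x -> Rabs (F x) <= C * Rabs (x - 1) ^ n) ->
  Rabs (avg 0 F s) <= C * Rabs (s - 1) ^ n / INR (S n).
Proof.
  intros HD HF Hs H.
  apply (norm_RInt_le (fun u => u ^ 0 * F (1 + u * (s - 1)))
    (fun u => scal (C * Rabs (s - 1) ^ n) (u ^ n)) 0 1); [lra| | |].
  - intros u Hu. change (Rabs (1 * F (1 + u * (s - 1))) <= C * Rabs (s - 1) ^ n * u ^ n).
    rewrite Rmult_1_l. eapply Rle_trans; [apply H, HD; auto|].
    replace (1 + u * (s - 1) - 1) with (u * (s - 1)) by ring.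
    rewrite Rabs_mult, (Rabs_right u), Rpow_mult_distr by lra. right; ring.
  - apply @RInt_correct. now apply ex_RInt_avg with D.
  - replace (C * Rabs (s - 1) ^ n / INR (S n)) with
      (C * Rabs (s - 1) ^ n * (1 ^ S n / INR (S n) - 0 ^ S n / INR (S n))).
    + apply (is_RInt_scal (fun u => u ^ n)), is_RInt_pow.
    + rewrite pow1, pow_i by lia. unfold Rdiv; ring.
Qed.

(** * Picard iteration at the pole *)

(** The Weierstrass M-test, through the uniform Cauchy criterion. *)
Lemma CVU_dom_sum_n (f : nat -> R -> R) (M : nat -> R) (D : R -> Prop) :
  (forall n x, D x -> Rabs (f n x) <= M n) -> ex_series M ->
  CVU_dom (fun n x => sum_n (fun k => f k x) n) D.
Proof.
  intros H HM. apply CVU_dom_cauchy. intros eps.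
  destruct (Cauchy_ex_series M HM eps) as [N HN].
  assert (W : forall n m x, D x -> (N <= n)%nat -> (n <= m)%nat ->
    Rabs (sum_n (fun k => f k x) m - sum_n (fun k => f k x) n) < eps).
  { intros n m x Hx Hn Hm.
    replace (sum_n (fun k => f k x) m - sum_n (fun k => f k x) n)
      with (sum_n_m (fun k => f k x) (S n) m) by now apply (sum_n_m_sum_n (fun k => f k x)).
    eapply Rle_lt_trans; [|apply (HN (S n) m); lia].
    eapply Rle_trans; [apply (norm_sum_n_m (fun k => f k x))|].
    eapply Rle_trans; [apply (sum_n_m_le _ M); intros k; now apply H|].
    apply Rle_abs. }
  exists N. intros n m x Hx Hn Hm. destruct (Nat.le_ge_cases n m).
  - rewrite Rabs_minus_sym. now apply W.
  - now apply W.
Qed.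

(** Termwise differentiation: the M-test applies both to the series and to the series of
    derivatives. *)
Lemma is_derive_Series (f df : nat -> R -> R) (M dM : nat -> R) (a c x : R) :
  (forall n y, a < y < c -> is_derive (f n) y (df n y)) ->
  (forall n y, a < y < c -> continuous (df n) y) ->
  (forall n y, a < y < c -> Rabs (f n y) <= M n) ->
  (forall n y, a < y < c -> Rabs (df n y) <= dM n) ->
  ex_series M -> ex_series dM -> a < x < c ->
  is_derive (fun y => Series (fun n => f n y)) x (Series (fun n => df n x)).
Proof.
  intros Hd Hc Hf Hdf HM HdM Hx.
  set (D := fun y => a < y < c).
  assert (HD : open D) by (apply open_and; [apply open_gt | apply open_lt]).
  assert (HS : forall n y, D y -> is_derive (fun y => sum_n (fun k => f k y) n) y
    (sum_n (fun k => df k y) n)).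
  { intros n y Hy. apply @is_derive_sum_n. intros; now apply Hd. }
  evar_last.
  - apply (CVU_Derive (fun n y => sum_n (fun k => f k y) n) D); auto.
    + intros y z t Hy Hz Ht; unfold D in *; lra.
    + now apply CVU_dom_sum_n with M.
    + intros n y Hy. eexists; now apply HS.
    + intros n y Hy. apply continuity_pt_filterlim.
      match goal with |- filterlim ?g _ _ => change (continuous g y) end.
      apply (continuous_ext_loc _ (fun y => sum_n (fun k => df k y) n)).
      * apply filter_imp with D; [|now apply HD].
        intros z Hz; symmetry; now apply is_derive_unique, HS.
      * clear HS. induction n.
        -- apply continuous_ext with (df O); [|now apply Hc].
           intros z; now rewrite sum_O.
        -- apply continuous_ext with (fun z => plus (sum_n (fun k => df k z) n) (df (S n) z)).
           ++ intros z; now rewrite sum_Sn.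
           ++ apply @continuous_plus; [exact IHn | now apply Hc].
    + intros eps. destruct (CVU_dom_sum_n df dM D Hdf HdM eps) as [N HN].
      exists N. intros n Hn y Hy. specialize (HN n Hn y Hy).
      rewrite (Lim_seq_ext _ (fun n => sum_n (fun k => df k y) n)).
      * replace (Derive (fun y => sum_n (fun k => f k y) n) y)
          with (sum_n (fun k => df k y) n)
          by (symmetry; now apply is_derive_unique, HS).
        exact HN.
      * intros k; now apply is_derive_unique, HS.
  - unfold Series. f_equal. apply Lim_seq_ext. intros n. now apply is_derive_unique, HS.
Qed.

Lemma continuous_bounded (f : R -> R) (a c : R) :
  a <= c -> (forall x, a <= x <= c -> continuous f x) ->
  exists M, 0 <= M /\ forall x, a <= x <= c -> Rabs (f x) <= M.
Proof.
  intros Hac Hf.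
  destruct (continuity_ab_maj (fun x => Rabs (f x)) a c Hac) as [m [Hm _]].
  - intros x Hx. apply continuity_pt_filterlim.
    apply (continuous_comp f Rabs); [now apply Hf | apply continuous_Rabs].
  - exists (Rabs (f m)); split; [apply Rabs_pos | exact Hm].
Qed.

(** The fundamental theorem of calculus: (s - 1) times the mean is the primitive of [F] that
    vanishes at the pole. *)
Lemma is_derive_primitive (D : R -> Prop) (F : R -> R) (s : R) :
  open D -> starlike D -> (forall x, D x -> continuous F x) -> D s ->
  is_derive (fun s => (s - 1) * avg 0 F s) s (F s).
Proof.
  intros HO HD HF Hs.
  apply (is_derive_RInt F (fun s => (s - 1) * avg 0 F s) 1 s); auto.
  apply filter_imp with D; [|now apply HO].
  intros x Hx. rewrite (avg_RInt D) by auto.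
  apply @RInt_correct, @ex_RInt_continuous. intros z Hz.
  now apply HF, (starlike_segment D x).
Qed.

(** Unbounded above so as to be an open neighbourhood of the north pole s = 1; the coefficient 1 /
    (1 + s) is singular only at the excluded end. *)
Definition off_south (s : R) : Prop := -1 < s.

Lemma open_off_south : open off_south.
Proof. apply open_gt. Qed.

Lemma starlike_interval (a c : R) : a < 1 < c -> starlike (fun s => a < s < c).
Proof. intros H s u Hs Hu. destruct (Rle_lt_dec s 1); split; nra. Qed.

Lemma starlike_off_south : starlike off_south.
Proof. intros s u Hs Hu. unfold off_south in *. destruct (Rle_lt_dec s 1); nra. Qed.

(** The n-th term of a Neumann series, not the n-th approximation: the solution is the sum over n.
    Each step applies the linear operator sending f to the primitive, from 1, of [K] times the mean
    of [r] f. *)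
Fixpoint picard (K r phi0 : R -> R) (n : nat) : R -> R :=
  match n with
  | O => phi0
  | S n => fun s =>
      (s - 1) * avg 0 (fun t => K t * avg 0 (fun t => r t * picard K r phi0 n t) t) s
  end.

Section Picard.

Variables (K r h phi0 : R -> R).
Hypothesis (HK : forall x, off_south x -> continuous K x).
Hypothesis (Hr : forall x, off_south x -> continuous r x).
Hypothesis (Hh : forall x, off_south x -> continuous h x).
Hypothesis (Hphi0 : forall x, off_south x -> is_derive phi0 x (h x)).

Let P := picard K r phi0.
Let w (n : nat) : R -> R := avg 0 (fun t => r t * P n t).
Let d (n : nat) : R -> R := match n with O => h | S n => fun x => K x * w n x end.

Lemma picard_continuous (n : nat) (x : R) : off_south x -> continuous (P n) x.
Proof.
  revert x; induction n; intros x Hx.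
  - apply @ex_derive_continuous. exists (h x); exact (Hphi0 x Hx).
  - apply @ex_derive_continuous. exists (K x * w n x).
    apply (is_derive_primitive off_south (fun t => K t * w n t));
      [exact open_off_south | exact starlike_off_south | | exact Hx].
    intros y Hy. apply (continuous_mult K (w n)); [exact (HK y Hy)|].
    apply (continuous_avg off_south 0 (fun t => r t * P n t));
      [exact open_off_south | exact starlike_off_south | | exact Hy].
    intros z Hz. apply (continuous_mult r (P n)); [exact (Hr z Hz) | exact (IHn z Hz)].
Qed.

Lemma picard_rP_continuous (n : nat) (x : R) :
  off_south x -> continuous (fun t => r t * P n t) x.
Proof.
  intros Hx. apply (continuous_mult r (P n)); [exact (Hr x Hx)|].
  exact (picard_continuous n x Hx).
Qed.

Lemma picard_Kw_continuous (n : nat) (x : R) :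
  off_south x -> continuous (fun t => K t * w n t) x.
Proof.
  intros Hx. apply (continuous_mult K (w n)); [exact (HK x Hx)|].
  apply (continuous_avg off_south 0 (fun t => r t * P n t));
    [exact open_off_south | exact starlike_off_south | | exact Hx].
  exact (picard_rP_continuous n).
Qed.

Lemma picard_is_derive (n : nat) (x : R) : off_south x -> is_derive (P n) x (d n x).
Proof.
  intros Hx; destruct n; [exact (Hphi0 x Hx)|].
  apply (is_derive_primitive off_south (fun t => K t * w n t));
    [exact open_off_south | exact starlike_off_south | | exact Hx].
  exact (picard_Kw_continuous n).
Qed.

Lemma picard_d_continuous (n : nat) (x : R) : off_south x -> continuous (d n) x.
Proof.
  destruct n; [exact (Hh x) | exact (picard_Kw_continuous n x)].
Qed.

(** If term n is at most C |x - 1|^n, then the outer mean contributes 1 / (n + 1), the primitive one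
    more factor |x - 1|, and the coefficients k q. This yields the terms of an exponential
    series. *)
Lemma picard_bound (a c : R) : -1 < a < 1 -> 1 < c ->
  exists B k q, 0 <= k /\ 0 <= q /\
  (forall x, a <= x <= c -> Rabs (K x) <= k) /\
  (forall x, a <= x <= c -> Rabs (r x) <= q) /\
  forall n x, a < x < c ->
    Rabs (P n x) <= B * ((k * q) ^ n / INR (fact n)) * Rabs (x - 1) ^ n /\
    Rabs (w n x) <= q * (B * ((k * q) ^ n / INR (fact n))) * Rabs (x - 1) ^ n.
Proof.
  intros Ha Hc.
  destruct (continuous_bounded K a c) as [k [Hk0 Hk]];
    [lra | intros; apply HK; unfold off_south; lra |].
  destruct (continuous_bounded r a c) as [q [Hq0 Hq]];
    [lra | intros; apply Hr; unfold off_south; lra |].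
  destruct (continuous_bounded phi0 a c) as [B [HB0 HB]];
    [lra | intros; apply (picard_continuous 0); unfold off_south; lra |].
  exists B, k, q. do 4 (split; auto).
  set (D := fun s => a < s < c).
  assert (HD : starlike D) by (apply starlike_interval; lra).
  assert (Hw : forall n, (forall x, D x -> Rabs (P n x) <=
      B * ((k * q) ^ n / INR (fact n)) * Rabs (x - 1) ^ n) ->
      forall x, D x -> Rabs (w n x) <=
      q * (B * ((k * q) ^ n / INR (fact n))) * Rabs (x - 1) ^ n).
  { intros n H x Hx.
    assert (Hp : 0 <= B * ((k * q) ^ n / INR (fact n))).
    { apply Rmult_le_pos; auto. apply Rdiv_le_0_compat; [|apply INR_fact_lt_0].
      apply pow_le; nra. }
    eapply Rle_trans; [apply (avg_bound D _ (q * (B * ((k * q) ^ n / INR (fact n)))) n); auto|].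
    - intros y Hy. apply picard_rP_continuous; unfold D, off_south in *; lra.
    - intros y Hy. rewrite Rabs_mult, Rmult_assoc.
      apply Rmult_le_compat; auto using Rabs_pos. apply Hq; unfold D in Hy; lra.
    (* The inner mean divides by n + 1 as well; this gain is discarded, and the factorial comes from
       the outer mean alone. *)
    - assert (1 <= INR (S n)) by (apply (le_INR 1); lia).
      assert (0 <= Rabs (x - 1) ^ n) by apply pow_le, Rabs_pos.
      apply Rmult_le_reg_r with (INR (S n)); [lra|].
      unfold Rdiv at 1. rewrite Rmult_assoc, Rinv_l, Rmult_1_r by lra.
      set (z := q * _) in *. assert (0 <= z) by (unfold z; nra).
      assert (0 <= z * Rabs (x - 1) ^ n) by nra. nra. }
  assert (HP : forall n x, D x -> Rabs (P n x) <=
      B * ((k * q) ^ n / INR (fact n)) * Rabs (x - 1) ^ n).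
  { induction n; intros x Hx.
    - simpl. unfold Rdiv. rewrite Rinv_1, !Rmult_1_r. apply HB; unfold D in Hx; lra.
    - specialize (Hw n IHn). unfold P; simpl picard. fold P.
      change (Rabs ((x - 1) * avg 0 (fun t => K t * w n t) x) <=
        B * ((k * q) ^ S n / INR (fact (S n))) * Rabs (x - 1) ^ S n).
      rewrite Rabs_mult.
      eapply Rle_trans; [apply Rmult_le_compat_l; [apply Rabs_pos|];
        apply (avg_bound D _ (k * (q * (B * ((k * q) ^ n / INR (fact n))))) n); auto|].
      + intros y Hy. apply picard_Kw_continuous; unfold D, off_south in *; lra.
      + intros y Hy. rewrite Rabs_mult, Rmult_assoc.
        apply Rmult_le_compat; auto using Rabs_pos. apply Hk; unfold D in Hy; lra.
      + right. rewrite fact_simpl, mult_INR. simpl pow. field. split.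
        * apply INR_fact_neq_0.
        * apply not_0_INR; lia. }
  intros n x Hx; split; [now apply HP | apply Hw; auto].
Qed.

(** The last conjunct supplies a primitive of [r] times the sum, from which [picard_sum]
    interchanges mean and series. *)
Lemma picard_local (x : R) : off_south x ->
  ex_series (fun n => d n x) /\
  is_derive (fun y => Series (fun n => P n y)) x (Series (fun n => d n x)) /\
  is_derive (fun y => Series (fun n => (y - 1) * w n y)) x (Series (fun n => r x * P n x)).
Proof.
  intros Hx. unfold off_south in Hx.
  (* An interval containing both [x] and the pole 1, with [a] halfway between -1 and the smaller of
     them, so that the coefficients are bounded on its closure. *)
  set (a := (Rmin x 1 - 1) / 2). set (c := Rmax x 1 + 1).
  assert (Hmin : -1 < Rmin x 1) by (apply Rmin_case; lra).
  pose proof (Rmin_l x 1); pose proof (Rmin_r x 1).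
  pose proof (Rmax_l x 1); pose proof (Rmax_r x 1).
  assert (Ha : -1 < a < 1) by (unfold a; lra).
  assert (Hc : 1 < c) by (unfold c; lra).
  assert (Hxac : a < x < c) by (unfold a, c; lra).
  destruct (picard_bound a c Ha Hc) as (B & k & q & Hk0 & Hq0 & Hk & Hq & HB).
  destruct (continuous_bounded h a c) as [bh [_ Hbh]];
    [lra | intros; apply Hh; unfold off_south; lra |].
  set (M := fun n => B * ((k * q) ^ n / INR (fact n)) * (c - a) ^ n).
  assert (HM : ex_series M).
  { apply ex_series_ext with (fun n => B * (((k * q) * (c - a)) ^ n * / INR (fact n))).
    - intros n. change (B * (((k * q) * (c - a)) ^ n * / INR (fact n)) = M n).
      unfold M. rewrite Rpow_mult_distr. unfold Rdiv; ring.
    - apply (ex_series_scal_l B (fun n => ((k * q) * (c - a)) ^ n * / INR (fact n))).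
      exists (exp ((k * q) * (c - a))).
      apply is_series_ext with (2 := is_exp_Reals ((k * q) * (c - a))).
      intros n. rewrite pow_n_pow. reflexivity. }
  assert (B0 : 0 <= B).
  { destruct (HB O 1) as [H3 _]; [lra|]. simpl in H3.
    pose proof (Rabs_pos (P 0 1)). lra. }
  assert (Hcoef : forall n, 0 <= B * ((k * q) ^ n / INR (fact n))).
  { intros n. apply Rmult_le_pos; auto. apply Rdiv_le_0_compat; [|apply INR_fact_lt_0].
    apply pow_le; nra. }
  assert (Hpow : forall n y, a < y < c -> Rabs (y - 1) ^ n <= (c - a) ^ n).
  { intros n y Hy. apply pow_incr. split; [apply Rabs_pos|].
    apply Rabs_le; lra. }
  assert (HPM : forall n y, a < y < c -> Rabs (P n y) <= M n).
  { intros n y Hy. eapply Rle_trans; [apply (HB n y Hy)|].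
    apply Rmult_le_compat_l; auto. }
  assert (HwM : forall n y, a < y < c -> Rabs (w n y) <= q * M n).
  { intros n y Hy. eapply Rle_trans; [apply (HB n y Hy)|].
    unfold M. rewrite Rmult_assoc. apply Rmult_le_compat_l; auto.
    apply Rmult_le_compat_l; auto. }
  assert (HD : forall y, a < y < c -> off_south y) by (unfold off_south; intros; lra).
  (* The index is shifted: the derivative of term n + 1 is [K] times the mean [w n], which is
     controlled by [M n]. *)
  set (dM := fun n => match n with O => bh | S n => (k * q) * M n end).
  assert (HdM : ex_series dM).
  { apply ex_series_incr_1. apply (ex_series_scal_l (k * q) M HM). }
  assert (Hd : forall n y, a < y < c -> Rabs (d n y) <= dM n).
  { intros [|n] y Hy; simpl; [apply Hbh; lra|].
    rewrite Rabs_mult, Rmult_assoc. apply Rmult_le_compat; auto using Rabs_pos.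
    apply Hk; lra. }
  split; [|split].
  - exact (@ex_series_le R_AbsRing R_CompleteNormedModule (fun n => d n x) dM
      (fun n => Hd n x Hxac) HdM).
  - exact (is_derive_Series P d M dM a c x (fun n y Hy => picard_is_derive n y (HD y Hy))
      (fun n y Hy => picard_d_continuous n y (HD y Hy)) HPM Hd HM HdM Hxac).
  - apply (is_derive_Series (fun n y => (y - 1) * w n y) (fun n y => r y * P n y)
      (fun n => (c - a) * (q * M n)) (fun n => q * M n) a c); try assumption.
    + intros n y Hy. apply (is_derive_primitive off_south (fun t => r t * P n t));
        [exact open_off_south | exact starlike_off_south | | exact (HD y Hy)].
      exact (picard_rP_continuous n).
    + intros n y Hy. apply picard_rP_continuous, HD, Hy.
    + intros n y Hy. rewrite Rabs_mult.
      apply Rmult_le_compat; try apply Rabs_pos; [|exact (HwM n y Hy)].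
      apply Rabs_le; lra.
    + intros n y Hy. rewrite Rabs_mult.
      apply Rmult_le_compat; try apply Rabs_pos; [|exact (HPM n y Hy)].
      apply Hq; lra.
    + apply (ex_series_scal_l (c - a) (fun n => q * M n)), (ex_series_scal_l q M HM).
    + apply (ex_series_scal_l q M HM).
Qed.

Lemma picard_sum (x : R) : off_south x ->
  is_derive (fun y => Series (fun n => P n y)) x
    (h x + K x * avg 0 (fun t => r t * Series (fun n => P n t)) x).
Proof.
  set (G := fun y => Series (fun n => P n y)).
  assert (HG : forall y, off_south y -> continuous (fun t => r t * G t) y).
  { intros y Hy. apply (continuous_mult r G); [exact (Hr y Hy)|].
    apply @ex_derive_continuous. exists (Series (fun n => d n y)).
    exact (proj1 (proj2 (picard_local y Hy))). }
  intros Hx. destruct (picard_local x Hx) as (Hex & HdG & _).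
  evar_last; [exact HdG|].
  rewrite Series_incr_1 by assumption. f_equal.
  change (Series (fun n => K x * w n x) = K x * avg 0 (fun t => r t * G t) x).
  rewrite Series_scal_l. f_equal.
  (* It remains to interchange mean and series. At the pole a mean is a value. Elsewhere, after
     multiplication by x - 1, both sides are primitives of the same function that vanish at 1. *)
  destruct (Req_dec x 1) as [->|Hn].
  - rewrite avg_at_1. unfold G. rewrite <- Series_scal_l.
    apply Series_ext. intros n. apply avg_at_1.
  - apply Rmult_eq_reg_l with (x - 1); [|lra].
    rewrite (avg_RInt off_south) by auto using starlike_off_south.
    rewrite <- Series_scal_l. symmetry.
    apply is_RInt_unique.
    set (V := fun y => Series (fun n => (y - 1) * w n y)).
    replace (Series (fun n => (x - 1) * w n x)) with (minus (V x) (V 1)).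
    + assert (HR : forall y, Rmin 1 x <= y <= Rmax 1 x -> off_south y)
        by (intros y; apply starlike_segment; [exact starlike_off_south | exact Hx]).
      apply (is_RInt_derive V); intros y Hy; apply HR in Hy;
        [|exact (HG y Hy)].
      evar_last; [exact (proj2 (proj2 (picard_local y Hy)))|]. apply Series_scal_l.
    + unfold V at 2. rewrite (Series_scal_l (1 - 1)).
      change (V x - (1 - 1) * Series (fun n => w n 1) = V x). ring.
Qed.

End Picard.

Lemma regular_exists (K r h : R -> R) (c0 : R) :
  (forall x, off_south x -> continuous K x) ->
  (forall x, off_south x -> continuous r x) ->
  (forall x, off_south x -> continuous h x) ->
  exists G : R -> R, G 1 = c0 /\
    forall x, off_south x -> is_derive G x (h x + K x * avg 0 (fun t => r t * G t) x).
Proof.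
  intros HK Hr Hh.
  set (phi0 := fun s => c0 + (s - 1) * avg 0 h s).
  exists (fun y => Series (fun n => picard K r phi0 n y)). split.
  (* At s = 1 every term after the first vanishes through its factor s - 1, so the sum there is
     [phi0 1], that is [c0]. *)
  - apply is_series_unique.
    apply (is_series_ext (fun n => match n with O => c0 | S _ => 0 end)).
    + intros [|n]; simpl; unfold phi0; ring.
    + apply is_series_decr_1.
      apply filterlim_ext with (fun _ => plus c0 (opp c0)).
      * intros n. transitivity (@zero R_NormedModule); [apply (plus_opp_r c0)|].
        symmetry. apply (@sum_n_m_const_zero R_NormedModule 0 n).
      * apply filterlim_const.
  - apply picard_sum; auto. intros x Hx. unfold phi0.
    evar_last.
    + apply @is_derive_plus; [apply @is_derive_const|].
      apply is_derive_primitive with off_south; auto using open_off_south, starlike_off_south.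
    + apply plus_zero_l.
Qed.

(** * The axisymmetric equation *)

Definition radius (b s : R) : R := sqrt (b ^ 2 + (1 - b ^ 2) * s ^ 2).

Lemma radicand_pos (b s : R) : 0 < b < 1 -> 0 < b ^ 2 + (1 - b ^ 2) * s ^ 2.
Proof.
  intros Hb. assert (0 < b ^ 2 < 1) by (split; nra).
  assert (0 <= s ^ 2) by apply pow2_ge_0. nra.
Qed.

Lemma radius_pos (b s : R) : 0 < b < 1 -> 0 < radius b s.
Proof. intros Hb. apply sqrt_lt_R0, radicand_pos, Hb. Qed.

Lemma radius_opp (b s : R) : radius b (- s) = radius b s.
Proof. unfold radius. f_equal. ring. Qed.

Lemma rho_radius (b th : R) : rho b th = radius b (sin th).
Proof.
  unfold rho, radius. f_equal. pose proof (sin2_cos2 th) as H. unfold Rsqr in H.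
  replace (cos th ^ 2) with (1 - sin th ^ 2) by (simpl; lra). ring.
Qed.

Lemma Ck_radius (b : R) (D : R -> Prop) (n : nat) :
  0 < b < 1 -> open D -> Ck D n (radius b).
Proof.
  intros Hb HD. apply Ck_sqrt; auto.
  - intros x _. now apply radicand_pos.
  - apply Ck_ext with (fun s => b ^ 2 + (1 - b ^ 2) * (s * s)); auto.
    + intros; simpl; ring.
    + apply Ck_plus; auto using Ck_const.
      repeat apply Ck_mult; auto using Ck_const, Ck_id.
Qed.

(* In the variable [s = sin theta] the axisymmetric equation is
   [((1 - s^2) / r * G')' = - (lam * r * G + 2 * om * s)].  Integrating it from
   the north pole [s = 1], where a bounded [G'] has zero flux, and dividing by
   [1 - s] removes the singularity there. *)
Definition regular (b lam om : R) (G : R -> R) : Prop :=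
  forall s, off_south s ->
    is_derive G s (om * radius b s
      + lam * (radius b s * / (1 + s)) * avg 0 (fun t => radius b t * G t) s).

Lemma Ck_regular_coef (b lam : R) (n : nat) :
  0 < b < 1 -> Ck off_south n (fun s => lam * (radius b s * / (1 + s))).
Proof.
  intros Hb. pose proof open_off_south.
  apply Ck_mult; auto using Ck_const. apply Ck_mult; auto using Ck_radius.
  apply (Ck_inv off_south n (fun s => 1 + s)); auto.
  - unfold off_south; intros; lra.
  - apply Ck_plus; auto using Ck_const, Ck_id.
Qed.

Lemma regular_solution (b lam om c : R) :
  0 < b < 1 -> exists G, G 1 = c /\ regular b lam om G.
Proof.
  intros Hb.
  apply (regular_exists (fun s => lam * (radius b s * / (1 + s))) (radius b)
    (fun s => om * radius b s)).
  - exact (Ck_regular_coef b lam 0 Hb).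
  - exact (Ck_radius b off_south 0 Hb open_off_south).
  - apply (Ck_mult off_south 0); auto using open_off_south, Ck_const, Ck_radius.
Qed.

Lemma regular_continuous (b lam om : R) (G : R -> R) :
  0 < b < 1 -> regular b lam om G ->
  forall s, off_south s -> continuous (fun t => radius b t * G t) s.
Proof.
  intros Hb HG. apply (Ck_mult off_south 0); auto using open_off_south, Ck_radius.
  intros s Hs. apply @ex_derive_continuous. eexists; exact (HG s Hs).
Qed.

(* [avg] preserves differentiability classes, so the integrated equation gains
   one derivative at each step, also at the pole. *)
Lemma regular_smooth (b lam om : R) (G : R -> R) :
  0 < b < 1 -> regular b lam om G -> smooth off_south G.
Proof.
  intros Hb HG. pose proof open_off_south as HO. intros n; induction n as [|n IH].
  - intros s Hs. apply @ex_derive_continuous. eexists; exact (HG s Hs).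
  - apply (Ck_intro off_south n G _ HO HG).
    apply Ck_plus; auto.
    + apply Ck_mult; auto using Ck_const, Ck_radius.
    + apply Ck_mult; auto using Ck_regular_coef.
      apply Ck_avg; auto using starlike_off_south.
      apply Ck_mult; auto using Ck_radius.
Qed.

Lemma regular_ext (b lam om : R) (F G : R -> R) :
  (forall s, off_south s -> F s = G s) -> regular b lam om F -> regular b lam om G.
Proof.
  intros H HF s Hs.
  rewrite <- (avg_ext 0 (fun t => radius b t * F t) _ off_south)
    by (auto using starlike_off_south; intros; now rewrite H).
  apply is_derive_ext_loc with F; [|now apply HF].
  apply filter_imp with off_south; [|now apply open_off_south]. intros; now apply H.
Qed.

Lemma regular_lin (b lam om c : R) (G H : R -> R) :
  0 < b < 1 -> regular b lam om G -> regular b lam 0 H ->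
  regular b lam om (fun s => G s + c * H s).
Proof.
  intros Hb HG HH s Hs.
  rewrite (avg_ext 0 _ (fun t => radius b t * G t + c * (radius b t * H t)) off_south)
    by (auto using starlike_off_south; intros; ring).
  rewrite (avg_lin off_south) by
    (eauto using starlike_off_south, regular_continuous).
  evar_last.
  - apply @is_derive_plus; [exact (HG s Hs)|].
    apply is_derive_scal. exact (HH s Hs).
  - unfold plus; simpl. ring.
Qed.

(** In the variable theta this is (cos theta / rho) g', the quantity differentiated in the
    Laplacian. *)
Definition flux (b : R) (G : R -> R) (s : R) : R :=
  (1 - s ^ 2) / radius b s * Derive G s.

(** Multiplying the integrated equation by (1 - s^2) / r cancels 1 / (1 + s) and leaves the flux as
    om (1 - s^2) minus [lam] times the primitive of r G from 1; differentiating recovers the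
    second-order equation. *)
Lemma is_derive_flux (b lam om : R) (G : R -> R) (s : R) :
  0 < b < 1 -> regular b lam om G -> off_south s ->
  is_derive (flux b G) s (- (lam * radius b s * G s + 2 * om * s)).
Proof.
  intros Hb HG Hs.
  apply is_derive_ext_loc with
    (fun s => om * (1 - s ^ 2) - lam * ((s - 1) * avg 0 (fun t => radius b t * G t) s)).
  - apply filter_imp with off_south; [|now apply open_off_south].
    intros t Ht. unfold flux. rewrite (is_derive_unique _ _ _ (HG t Ht)).
    pose proof (radius_pos b t Hb). unfold off_south in Ht. eq_in_R. field. lra.
  - evar_last.
    + apply @is_derive_minus.
      * apply (is_derive_scal (fun s => 1 - s ^ 2)). auto_derive; [exact I | reflexivity].
      * apply is_derive_scal, is_derive_primitive with off_south;
          eauto using open_off_south, starlike_off_south, regular_continuous.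
    + unfold minus, plus, opp; simpl. ring.
Qed.

(** N exp(- C x) has nonpositive derivative and starts at 0, so the nonnegative N cannot leave 0. *)
Lemma gronwall_zero (N dN : R -> R) (C s : R) :
  0 <= s -> N 0 = 0 ->
  (forall x, 0 <= x <= s ->
     0 <= N x /\ is_derive N x (dN x) /\ dN x <= C * N x) ->
  N s = 0.
Proof.
  intros Hs H0 H.
  assert (Hd : forall x, 0 <= x <= s ->
    is_derive (fun x => N x * exp (- C * x)) x ((dN x - C * N x) * exp (- C * x))).
  { intros x Hx. destruct (H x Hx) as (_ & Hx' & _).
    evar_last.
    - apply (Derive.is_derive_mult N (fun x => exp (- C * x))); [exact Hx'|].
      auto_derive; [exact I | reflexivity].
    - simpl. ring. }
  destruct (MVT_gen (fun x => N x * exp (- C * x)) 0 s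
    (fun x => (dN x - C * N x) * exp (- C * x))) as (c & Hc & E);
    rewrite ?Rmin_left, ?Rmax_right in * by lra.
  - intros x Hx; apply Hd; lra.
  - intros x Hx. apply continuity_pt_filterlim, (ex_derive_continuous (fun x => N x * exp (- C * x))).
    eexists; now apply Hd.
  - rewrite H0 in E. destruct (H c Hc) as (_ & _ & Hle).
    destruct (H s) as (Hpos & _); [lra|].
    pose proof (exp_pos (- C * c)). pose proof (exp_pos (- C * s)).
    assert ((dN c - C * N c) * exp (- C * c) * (s - 0) <= 0).
    { assert ((C * N c - dN c) * exp (- C * c) >= 0) by nra. nra. }
    nra.
Qed.

(* The even part of [G] and its flux solve a homogeneous linear first-order
   system with zero data at [s = 0]. *)
Lemma regular_odd_nonneg (b lam om : R) (G : R -> R) (s : R) :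
  0 < b < 1 -> regular b lam om G -> G 0 = 0 -> 0 <= s < 1 -> G (- s) = - G s.
Proof.
  intros Hb HG H0 Hs.
  set (E := fun x => G x + G (- x)).
  set (Z := fun x => flux b G x - flux b G (- x)).
  set (q := fun x => radius b x / (1 - x ^ 2) - lam * radius b x).
  assert (HE : forall x, 0 <= x <= s ->
    is_derive E x (radius b x / (1 - x ^ 2) * Z x)).
  { intros x Hx.
    assert (D1 : is_derive G x (Derive G x)).
    { apply Derive_correct. eexists; apply HG; unfold off_south; lra. }
    assert (D2 : is_derive G (- x) (Derive G (- x))).
    { apply Derive_correct. eexists; apply HG; unfold off_south; lra. }
    evar_last.
    - apply @is_derive_plus; [exact D1|].
      apply (is_derive_comp G); [exact D2|].
      apply @is_derive_opp, @is_derive_id.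
    - unfold Z, flux, plus, scal, opp, one; simpl; unfold mult; simpl.
      rewrite radius_opp. pose proof (radius_pos b x Hb). eq_in_R. field. split; nra. }
  (* The source is odd, so its contributions at x and - x cancel and the system for [E] and [Z] is
     homogeneous. *)
  assert (HZ : forall x, 0 <= x <= s ->
    is_derive Z x (- lam * radius b x * E x)).
  { intros x Hx. evar_last.
    - apply @is_derive_minus.
      + apply is_derive_flux; eauto; unfold off_south; lra.
      + apply (is_derive_comp (flux b G)).
        * apply is_derive_flux; eauto; unfold off_south; lra.
        * apply @is_derive_opp, @is_derive_id.
    - unfold E, minus, plus, scal, opp, one; simpl; unfold mult; simpl.
      rewrite radius_opp. ring. }
  destruct (continuous_bounded q 0 s) as (C & HC0 & HC); [lra| |].
  { intros x Hx. apply @ex_derive_continuous. unfold q.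
    assert (ex_derive (radius b) x).
    { apply (Ck_radius b everywhere 1 Hb open_everywhere); exact I. }
    auto_derive. repeat split; auto; nra. }
  assert (HN : E s ^ 2 + Z s ^ 2 = 0).
  { apply (gronwall_zero (fun x => E x ^ 2 + Z x ^ 2)
      (fun x => 2 * (E x * Z x) * q x) C s); [lra| |].
    - unfold E, Z. replace (- 0) with 0 by ring. rewrite H0. ring.
    - intros x Hx. split; [nra|]. split.
      + evar_last.
        * apply @is_derive_plus; apply is_derive_pow; [apply HE | apply HZ]; auto.
        * unfold q, plus; simpl. ring.
      + specialize (HC x Hx). cbv beta.
        generalize dependent (q x). generalize (E x) (Z x). intros e z qx HC.
        apply Rabs_le_between in HC.
        pose proof (pow2_ge_0 (e - z)). pose proof (pow2_ge_0 (e + z)).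
        (* Half the sum of this product and the next is C (e^2 + z^2) - 2 e z qx, the inequality
           wanted. *)
        assert (0 <= (e + z) ^ 2 * (C - qx)) by (apply Rmult_le_pos; lra).
        assert (0 <= (e - z) ^ 2 * (C + qx)) by (apply Rmult_le_pos; lra).
        nra. }
  assert (E s = 0) by nra. unfold E in *. lra.
Qed.

(** For odd [G] this changes nothing on (-1, 1); it replaces the uncontrolled values at and beyond
    the south pole by reflected ones. *)
Definition oddext (G : R -> R) (s : R) : R :=
  if Rle_dec 0 s then G s else - G (- s).

(** The half-lines s > -1 and s < 1 cover R. The extension is [G] on the first and - G(- s) on the
    second, so no derivatives have to be matched at s = 0. *)
Lemma regular_oddext (b lam om : R) (G : R -> R) :
  0 < b < 1 -> regular b lam om G -> G 0 = 0 ->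
  smooth everywhere (oddext G) /\ regular b lam om (oddext G).
Proof.
  intros Hb HG H0.
  assert (HR : forall s, off_south s -> G s = oddext G s).
  { intros s Hs. unfold oddext, off_south in *. destruct (Rle_dec 0 s); auto.
    rewrite <- (regular_odd_nonneg b lam om G (- s) Hb HG H0) by lra.
    f_equal; ring. }
  assert (HL : forall s, s < 1 -> -1 * G (-1 * s) = oddext G s).
  { intros s Hs. replace (-1 * s) with (- s) by ring. unfold oddext.
    destruct (Rle_dec 0 s); [|ring].
    rewrite (regular_odd_nonneg b lam om G s Hb HG H0) by lra. ring. }
  split; [|now apply regular_ext with G].
  intros n. apply Ck_cover with off_south (fun s => s < 1).
  - intros s _. unfold off_south. lra.
  - apply Ck_ext with G; auto using open_off_south. now apply (regular_smooth b lam om).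
  - apply Ck_ext with (fun s => -1 * G (-1 * s)); auto using open_lt.
    apply Ck_mult; auto using open_lt, Ck_const.
    apply Ck_comp with off_south; auto using open_lt.
    + unfold off_south; intros; lra.
    + now apply (regular_smooth b lam om).
    + apply Ck_mult; auto using open_lt, Ck_const, Ck_id.
Qed.

Lemma regular_alternative (b lam om : R) : 0 < b < 1 ->
  (exists G, smooth everywhere G /\ regular b lam om G) \/
  (exists H, smooth everywhere H /\ regular b lam 0 H /\ H 1 = 1).
Proof.
  intros Hb.
  destruct (regular_solution b lam 0 1 Hb) as (H & H1 & HH).
  destruct (Req_dec (H 0) 0) as [E|E].
  - right. exists (oddext H). destruct (regular_oddext b lam 0 H Hb HH E).
    split; [|split]; auto. unfold oddext. destruct (Rle_dec 0 1); [auto | lra].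
  - left. destruct (regular_solution b lam om 0 Hb) as (P & _ & HP).
    (* The coefficient makes the combination vanish at the equator. *)
    exists (oddext (fun s => P s + - (P 0 / H 0) * H s)).
    apply regular_oddext; auto; [now apply regular_lin | now field].
Qed.

(** * Smooth functions on R^3 along curves *)

Lemma iter_partial3_height (h : R -> R) (l : list nat) :
  smooth everywhere h ->
  exists h', smooth everywhere h' /\
    forall x y z, iter_partial3 l (fun _ _ z => h z) x y z = h' z.
Proof.
  intros Hh. induction l as [|i l (h' & Hh' & E)].
  - exists h; auto.
  - destruct i as [|[|i]].
    1,2: exists (fun _ => 0); split; [intros n; apply Ck_const|];
      intros x y z; simpl; rewrite (Derive_ext _ (fun _ => h' z)) by (intros; apply E);
      apply Derive_const.
    exists (Derive h'). split; [now apply smooth_Derive|].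
    intros x y z; simpl. apply Derive_ext. intros; apply E.
Qed.

(** An axisymmetric function of sin theta extends to R^3 as a function of the height alone; this is
    how [H] is shown to be smooth on the ellipsoid. *)
Lemma smooth3_height (h : R -> R) :
  smooth everywhere h -> smooth3 (fun _ _ z => h z).
Proof.
  intros Hh l. destruct (iter_partial3_height h l Hh) as (h' & Hh' & E).
  split.
  - intros p. apply continuous_ext with (fun q : R * R * R => h' (snd q)).
    + intros q; symmetry; apply E.
    + apply (continuous_comp (fun q : R * R * R => snd q) h').
      * destruct p; apply continuous_snd.
      * exact (Hh' O _ I).
  - intros i x y z. destruct i as [|[|i]]; simpl.
    + apply ex_derive_ext with (fun _ => h' z);
        [intros; symmetry; apply E | apply ex_derive_const].
    + apply ex_derive_ext with (fun _ => h' z);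
        [intros; symmetry; apply E | apply ex_derive_const].
    + apply ex_derive_ext with h'; [intros; symmetry; apply E|].
      now apply (smooth_ex_derive everywhere).
Qed.

Lemma smooth3_partial3 (i : nat) (F : R -> R -> R -> R) :
  smooth3 F -> smooth3 (partial3 i F).
Proof.
  (* [fold_right] applies the last index of the list first, so the extra derivative is appended at
     the end. *)
  intros H l. generalize (H (l ++ (i :: nil))).
  unfold iter_partial3. rewrite fold_right_app. auto.
Qed.

Lemma smooth3_continuous (F : R -> R -> R -> R) (x y z e : R) :
  smooth3 F -> 0 < e ->
  exists d, 0 < d /\ forall x' y' z',
    Rabs (x' - x) < d -> Rabs (y' - y) < d -> Rabs (z' - z) < d ->
    Rabs (F x' y' z' - F x y z) < e.
Proof.
  intros HF He. destruct (HF nil) as [Hc _].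
  specialize (Hc (x, y, z)). simpl in Hc.
  destruct (proj1 (filterlim_locally _ _) Hc (mkposreal e He)) as [d Hd].
  exists d; split; [apply cond_pos|]. intros x' y' z' Hx Hy Hz.
  apply (Hd (x', y', z')). repeat split; assumption.
Qed.

Lemma MVT_point (f : R -> R) (a b : R) : (forall x, ex_derive f x) ->
  exists c, Rabs (c - a) <= Rabs (b - a) /\ f b - f a = Derive f c * (b - a).
Proof.
  intros H. destruct (MVT_gen f a b (Derive f)) as (c & Hc & E).
  - intros x _; now apply Derive_correct.
  - intros x _. apply continuity_pt_filterlim, (ex_derive_continuous f), H.
  - exists c; split; auto. revert Hc.
    unfold Rmin, Rmax. destruct (Rle_dec a b); intros Hc; unfold Rabs;
      destruct (Rcase_abs (c - a)), (Rcase_abs (b - a)); lra.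
Qed.

Lemma is_derive_small_o (f : R -> R) (t l : R) :
  (forall e, 0 < e -> exists d, 0 < d /\ forall h, Rabs h < d ->
     Rabs (f (t + h) - f t - l * h) <= e * Rabs h) ->
  is_derive f t l.
Proof.
  intros H. apply is_derive_Reals. intros e He.
  destruct (H (e / 2)) as (d & Hd & Hf); [lra|].
  exists (mkposreal d Hd). intros h Hh Hlt. simpl in Hlt.
  specialize (Hf h Hlt). assert (0 < Rabs h) by now apply Rabs_pos_lt.
  replace ((f (t + h) - f t) / h - l) with ((f (t + h) - f t - l * h) / h) by (field; auto).
  unfold Rdiv. rewrite Rabs_mult, Rabs_inv.
  apply Rmult_lt_reg_r with (Rabs h); auto.
  rewrite Rmult_assoc, Rinv_l by lra. nra.
Qed.

Lemma is_derive_local_lipschitz (x : R -> R) (t dx e : R) :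
  is_derive x t dx -> 0 < e ->
  exists d, 0 < d /\ forall h, Rabs h < d ->
    Rabs (x (t + h) - x t - dx * h) <= e * Rabs h.
Proof.
  intros H He. apply is_derive_Reals in H.
  destruct (H e He) as [d Hd]. exists d; split; [apply cond_pos|].
  intros h Hh. destruct (Req_dec h 0) as [->|Hn].
  - rewrite Rplus_0_r. replace (x t - x t - dx * 0) with 0 by ring.
    rewrite Rabs_R0; lra.
  - specialize (Hd h Hn Hh).
    replace (x (t + h) - x t - dx * h) with (((x (t + h) - x t) / h - dx) * h)
      by (field; auto).
    rewrite Rabs_mult. apply Rmult_le_compat_r; [apply Rabs_pos | lra].
Qed.

Lemma is_derive_increment (x : R -> R) (t dx e delta : R) :
  is_derive x t dx -> 0 < e -> 0 < delta ->
  exists d, 0 < d /\ forall h, Rabs h < d ->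
    Rabs (x (t + h) - x t) < delta /\ Rabs (x (t + h) - x t - dx * h) <= e * Rabs h.
Proof.
  intros H He Hdelta. destruct (is_derive_local_lipschitz x t dx e H He) as (d & Hd & Hx).
  pose proof (Rabs_pos dx).
  assert (Hq : 0 < delta / (Rabs dx + e)) by (apply Rdiv_lt_0_compat; lra).
  exists (Rmin d (delta / (Rabs dx + e))). split; [now apply Rmin_case|].
  intros h Hh. pose proof (Rmin_l d (delta / (Rabs dx + e))).
  pose proof (Rmin_r d (delta / (Rabs dx + e))).
  specialize (Hx h ltac:(lra)). split; auto.
  replace (x (t + h) - x t) with ((x (t + h) - x t - dx * h) + dx * h) by ring.
  eapply Rle_lt_trans; [apply Rabs_triang|]. rewrite (Rabs_mult dx).
  apply Rle_lt_trans with ((Rabs dx + e) * Rabs h); [lra|].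
  replace delta with ((Rabs dx + e) * (delta / (Rabs dx + e))) by (field; lra).
  apply Rmult_lt_compat_l; lra.
Qed.

Lemma product_increment (A A0 X dx h e : R) :
  0 < e <= 1 -> Rabs (A - A0) <= e -> Rabs (X - dx * h) <= e * Rabs h ->
  Rabs (A * X - A0 * dx * h) <= e * (Rabs dx + 1 + Rabs A0) * Rabs h.
Proof.
  intros He HA HX.
  replace (A * X - A0 * dx * h)
    with ((A - A0) * (X - dx * h) + (A - A0) * dx * h + A0 * (X - dx * h)) by ring.
  eapply Rle_trans; [apply Rabs_triang|].
  eapply Rle_trans; [apply Rplus_le_compat_r, Rabs_triang|].
  rewrite !Rabs_mult. pose proof (Rabs_pos h). pose proof (Rabs_pos dx).
  pose proof (Rabs_pos A0). pose proof (Rabs_pos (A - A0)).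
  pose proof (Rabs_pos (X - dx * h)).
  assert (Rabs (A - A0) * Rabs (X - dx * h) <= 1 * (e * Rabs h))
    by (apply Rmult_le_compat; lra).
  assert (Rabs (A - A0) * Rabs dx * Rabs h <= e * Rabs dx * Rabs h).
  { apply Rmult_le_compat_r; auto. apply Rmult_le_compat_r; auto. }
  assert (Rabs A0 * Rabs (X - dx * h) <= Rabs A0 * (e * Rabs h))
    by (apply Rmult_le_compat_l; auto).
  lra.
Qed.

(** [smooth3] provides partial derivatives and their joint continuity, not differentiability. The
    increment is split into moves along one axis at a time, each treated by the mean value
    theorem. *)
Lemma is_derive_comp3 (F : R -> R -> R -> R) (x y z : R -> R) (t dx dy dz : R) :
  smooth3 F -> is_derive x t dx -> is_derive y t dy -> is_derive z t dz ->
  is_derive (fun t => F (x t) (y t) (z t)) t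
    (partial3 0 F (x t) (y t) (z t) * dx + partial3 1 F (x t) (y t) (z t) * dy
     + partial3 2 F (x t) (y t) (z t) * dz).
Proof.
  intros HF Hx Hy Hz.
  assert (D0 : forall b c a, ex_derive (fun u => F u b c) a)
    by (intros b c a; exact (proj2 (HF nil) 0%nat a b c)).
  assert (D1 : forall a c b, ex_derive (fun u => F a u c) b)
    by (intros a c b; exact (proj2 (HF nil) 1%nat a b c)).
  assert (D2 : forall a b c, ex_derive (fun u => F a b u) c)
    by (intros a b c; exact (proj2 (HF nil) 2%nat a b c)).
  set (A := partial3 0 F (x t) (y t) (z t)). set (B := partial3 1 F (x t) (y t) (z t)).
  set (C := partial3 2 F (x t) (y t) (z t)).
  (* The sum of the three constants of [product_increment]; the tolerance e' below is chosen so that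
     e' S <= e. *)
  set (S := (Rabs dx + 1 + Rabs A) + (Rabs dy + 1 + Rabs B) + (Rabs dz + 1 + Rabs C)).
  assert (HS : 0 < S).
  { unfold S. pose proof (Rabs_pos dx). pose proof (Rabs_pos dy). pose proof (Rabs_pos dz).
    pose proof (Rabs_pos A). pose proof (Rabs_pos B). pose proof (Rabs_pos C). lra. }
  apply is_derive_small_o. intros e He.
  set (e' := Rmin 1 (e / S)).
  assert (He' : 0 < e' <= 1).
  { split; [|apply Rmin_l]. apply Rmin_case; [lra | now apply Rdiv_lt_0_compat]. }
  assert (HeS : e' * S <= e).
  { replace e with (e / S * S) by (field; lra).
    apply Rmult_le_compat_r; [lra | apply Rmin_r]. }
  destruct (smooth3_continuous _ (x t) (y t) (z t) e' (smooth3_partial3 0 F HF) (proj1 He'))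
    as (d0 & Hd0 & C0).
  destruct (smooth3_continuous _ (x t) (y t) (z t) e' (smooth3_partial3 1 F HF) (proj1 He'))
    as (d1 & Hd1 & C1).
  destruct (smooth3_continuous _ (x t) (y t) (z t) e' (smooth3_partial3 2 F HF) (proj1 He'))
    as (d2 & Hd2 & C2).
  set (d := Rmin d0 (Rmin d1 d2)).
  assert (Hd : 0 < d) by (unfold d; repeat apply Rmin_case; auto).
  assert (Hdd : d <= d0 /\ d <= d1 /\ d <= d2).
  { unfold d. pose proof (Rmin_l d0 (Rmin d1 d2)). pose proof (Rmin_r d0 (Rmin d1 d2)).
    pose proof (Rmin_l d1 d2). pose proof (Rmin_r d1 d2). lra. }
  destruct (is_derive_increment x t dx e' d Hx (proj1 He') Hd) as (rx & Hrx & Ix).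
  destruct (is_derive_increment y t dy e' d Hy (proj1 He') Hd) as (ry & Hry & Iy).
  destruct (is_derive_increment z t dz e' d Hz (proj1 He') Hd) as (rz & Hrz & Iz).
  exists (Rmin rx (Rmin ry rz)). split; [repeat apply Rmin_case; auto|].
  intros h Hh.
  pose proof (Rmin_l rx (Rmin ry rz)). pose proof (Rmin_r rx (Rmin ry rz)).
  pose proof (Rmin_l ry rz). pose proof (Rmin_r ry rz).
  destruct (Ix h) as [Ix1 Ix2]; [lra|]. destruct (Iy h) as [Iy1 Iy2]; [lra|].
  destruct (Iz h) as [Iz1 Iz2]; [lra|].
  (* Telescoping: x moves with y and z already at their new values, then y with the old x and new z,
     then z with the old x and y. *)
  destruct (MVT_point (fun u => F u (y (t + h)) (z (t + h))) (x t) (x (t + h)) (D0 _ _))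
    as (cx & Hcx & Ex).
  destruct (MVT_point (fun u => F (x t) u (z (t + h))) (y t) (y (t + h)) (D1 _ _))
    as (cy & Hcy & Ey).
  destruct (MVT_point (fun u => F (x t) (y t) u) (z t) (z (t + h)) (D2 _ _))
    as (cz & Hcz & Ez).
  set (A' := partial3 0 F cx (y (t + h)) (z (t + h))).
  set (B' := partial3 1 F (x t) cy (z (t + h))).
  set (C' := partial3 2 F (x t) (y t) cz).
  assert (Z0 : forall u v, v > 0 -> Rabs (u - u) < v).
  { intros u v Hv. unfold Rminus. rewrite Rplus_opp_r, Rabs_R0. exact Hv. }
  assert (HA : Rabs (A' - A) <= e') by (left; apply C0; lra).
  assert (HB : Rabs (B' - B) <= e') by (left; apply C1; try apply Z0; lra).
  assert (HC : Rabs (C' - C) <= e') by (left; apply C2; try apply Z0; lra).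
  pose proof (product_increment A' A _ dx h e' He' HA Ix2) as Px.
  pose proof (product_increment B' B _ dy h e' He' HB Iy2) as Py.
  pose proof (product_increment C' C _ dz h e' He' HC Iz2) as Pz.
  change (Derive (fun u => F u (y (t + h)) (z (t + h))) cx) with A' in Ex.
  change (Derive (fun u => F (x t) u (z (t + h))) cy) with B' in Ey.
  change (Derive (fun u => F (x t) (y t) u) cz) with C' in Ez.
  replace (F (x (t + h)) (y (t + h)) (z (t + h)) - F (x t) (y t) (z t)
    - (A * dx + B * dy + C * dz) * h) with
    ((A' * (x (t + h) - x t) - A * dx * h) + (B' * (y (t + h) - y t) - B * dy * h)
     + (C' * (z (t + h) - z t) - C * dz * h)) by lra.
  eapply Rle_trans; [apply Rabs_triang|].
  eapply Rle_trans; [apply Rplus_le_compat_r, Rabs_triang|].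
  apply Rle_trans with (e' * S * Rabs h).
  - unfold S. lra.
  - apply Rmult_le_compat_r; [apply Rabs_pos | exact HeS].
Qed.

(** * The equations on the ellipsoid *)

(** [a] and [c] stand for cos phi and sin phi. [F] varies in the induction because each derivative
    brings in its partial derivatives. *)
Lemma smooth_meridian (F : R -> R -> R -> R) (a b c : R) :
  smooth3 F -> smooth everywhere (fun t => F (a * cos t) (c * cos t) (b * sin t)).
Proof.
  intros HF n. revert F HF. pose proof open_everywhere as HO.
  assert (D : forall F, smooth3 F -> forall t, everywhere t ->
    is_derive (fun t => F (a * cos t) (c * cos t) (b * sin t)) t
      (partial3 0 F (a * cos t) (c * cos t) (b * sin t) * (- a * sin t)
       + partial3 1 F (a * cos t) (c * cos t) (b * sin t) * (- c * sin t)
       + partial3 2 F (a * cos t) (c * cos t) (b * sin t) * (b * cos t))).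
  { intros F HF t _.
    apply (is_derive_comp3 F (fun t => a * cos t) (fun t => c * cos t) (fun t => b * sin t)); auto;
      auto_derive; auto; ring. }
  induction n as [|n IH]; intros F HF.
  - intros t Ht. apply @ex_derive_continuous. eexists; now apply D.
  - eapply Ck_intro; [exact HO | now apply D|].
    destruct (Ck_sin_cos n) as [Hs Hc].
    apply Ck_plus; [auto | apply Ck_plus; [auto| |] |];
      (apply Ck_mult; [auto | now apply IH, smooth3_partial3|]);
      apply Ck_mult; auto using Ck_const.
Qed.

(** [psi] is unconstrained outside the closed band of latitudes; [v] and [w] are globally smooth
    substitutes along one meridian. *)
Lemma ellipsoid_meridian (b : R) (psi : R -> R -> C) (phi : R) :
  smooth_on_ellipsoid b psi ->
  exists v w, smooth everywhere v /\ smooth everywhere w /\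
    forall t, - (PI / 2) <= t <= PI / 2 ->
      ReF psi phi t = v t /\ ImF psi phi t = w t.
Proof.
  intros (Fr & Fi & HFr & HFi & E).
  exists (fun t => Fr (cos phi * cos t) (sin phi * cos t) (b * sin t)).
  exists (fun t => Fi (cos phi * cos t) (sin phi * cos t) (b * sin t)).
  split; [now apply smooth_meridian | split; [now apply smooth_meridian|]].
  intros t Ht. unfold ReF, ImF. rewrite E by assumption. auto.
Qed.

Lemma smooth_cos_div_rho (b : R) :
  0 < b < 1 -> smooth everywhere (fun t => cos t / rho b t).
Proof.
  intros Hb n. pose proof open_everywhere as HO.
  destruct (Ck_sin_cos n) as [Hs Hc].
  apply Ck_mult; auto. apply Ck_inv; auto.
  - intros t _. rewrite rho_radius. pose proof (radius_pos b (sin t) Hb). lra.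
  - apply Ck_ext with (fun t => radius b (sin t)); auto.
    + intros; now rewrite rho_radius.
    + apply Ck_comp with everywhere; auto using Ck_radius.
Qed.

Lemma locally_interior (th : R) (P : R -> Prop) :
  - (PI / 2) < th < PI / 2 -> (forall t, - (PI / 2) < t < PI / 2 -> P t) ->
  locally th P.
Proof.
  intros Hth H. apply filter_imp with (fun t => - (PI / 2) < t < PI / 2); auto.
  apply (open_and _ _ (open_gt (- (PI / 2))) (open_lt (PI / 2))). exact Hth.
Qed.

Definition radial_Lap (b : R) (g : R -> R) (th : R) : R :=
  / (cos th * rho b th) * Derive (fun t => cos t / rho b t * Derive g t) th.

Lemma LapR_radial (b : R) (g : R -> R) (phi th : R) :
  LapR b (fun _ t => g t) phi th = radial_Lap b g th.
Proof.
  unfold LapR, radial_Lap, dphi, dth.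
  rewrite (Derive_ext (fun t => Derive (fun _ => g th) t) (fun _ => 0))
    by (intros; apply Derive_const).
  rewrite Derive_const, Rmult_0_r, Rplus_0_l. reflexivity.
Qed.

Lemma radial_Lap_0 (b th : R) : radial_Lap b (fun _ => 0) th = 0.
Proof.
  unfold radial_Lap. rewrite (Derive_ext _ (fun _ => 0)).
  - rewrite Derive_const. ring.
  - intros t. rewrite Derive_const. ring.
Qed.

(** The difference quotients are identical, so this is an equality of total derivatives; it carries
    the second phi-derivative of [Y] through the Laplacian unexamined. *)
Lemma Derive_const_plus (f : R -> R) (c x : R) :
  Derive (fun t => c + f t) x = Derive f x.
Proof.
  unfold Derive. f_equal. apply Lim_ext. intros h. f_equal. ring.
Qed.

Lemma LapR_plus_radial (b : R) (g v : R -> R) (u : R -> R -> R) (phi th : R) :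
  0 < b < 1 -> smooth everywhere g -> smooth everywhere v ->
  (forall t, - (PI / 2) <= t <= PI / 2 -> u phi t = v t) ->
  - (PI / 2) < th < PI / 2 ->
  LapR b (fun p t => g t + u p t) phi th = radial_Lap b g th + LapR b u phi th.
Proof.
  intros Hb Hg Hv Hu Hth.
  assert (Huv : forall t, - (PI / 2) < t < PI / 2 -> locally t (fun s => v s = u phi s)).
  { intros t Ht. apply locally_interior; auto. intros; symmetry; apply Hu; lra. }
  assert (Ek : forall f, smooth everywhere f ->
    ex_derive (fun t => cos t / rho b t * Derive f t) th).
  { intros f Hf. apply (Ck_mult everywhere 1 (fun t => cos t / rho b t) (Derive f));
      [apply open_everywhere | now apply smooth_cos_div_rho | now apply smooth_Derive | exact I]. }
  unfold LapR, radial_Lap, dphi, dth.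
  rewrite (Derive_ext (fun t => Derive (fun s => g th + u s th) t)
    (fun t => Derive (fun s => u s th) t)) by (intros; apply Derive_const_plus).
  rewrite (Derive_ext_loc (fun t => cos t / rho b t * Derive (fun s => g s + u phi s) t)
    (fun t => cos t / rho b t * Derive g t + cos t / rho b t * Derive (fun s => u phi s) t)).
  - rewrite Derive_plus; [cbv beta; ring | now apply Ek|].
    apply ex_derive_ext_loc with (fun t => cos t / rho b t * Derive v t); [|now apply Ek].
    apply locally_interior; auto. intros t Ht. f_equal. now apply Derive_ext_loc, Huv.
  - apply locally_interior; auto. intros t Ht.
    rewrite Derive_plus; [apply Rmult_plus_distr_l | now apply (smooth_ex_derive everywhere)|].
    apply ex_derive_ext_loc with v; [now apply Huv | now apply (smooth_ex_derive everywhere)].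
Qed.

Lemma smooth_comp_sin (G : R -> R) :
  smooth everywhere G -> smooth everywhere (fun t => G (sin t)).
Proof.
  intros HG n. apply Ck_comp with everywhere; auto using open_everywhere.
  apply Ck_sin_cos.
Qed.

Lemma Derive_comp_sin (G : R -> R) (t : R) :
  smooth everywhere G -> Derive (fun t => G (sin t)) t = cos t * Derive G (sin t).
Proof.
  intros HG. rewrite (Derive_comp G sin).
  - f_equal. apply is_derive_unique, is_derive_sin.
  - now apply (smooth_ex_derive everywhere).
  - eexists; apply is_derive_sin.
Qed.

Lemma radial_equation (b lam om : R) (G : R -> R) (th : R) :
  0 < b < 1 -> smooth everywhere G -> regular b lam om G ->
  - (PI / 2) < th < PI / 2 ->
  radial_Lap b (fun t => G (sin t)) th
    = - lam * G (sin th) - 2 * om * sin th / rho b th.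
Proof.
  intros Hb HG HR Hth.
  assert (Hc : 0 < cos th) by (apply cos_gt_0; lra).
  pose proof (radius_pos b (sin th) Hb).
  assert (Hs : off_south (sin th)).
  { unfold off_south. pose proof (sin2_cos2 th) as H1. unfold Rsqr in H1. nra. }
  unfold radial_Lap.
  replace (Derive (fun t => cos t / rho b t * Derive (fun s => G (sin s)) t) th)
    with (cos th * - (lam * radius b (sin th) * G (sin th) + 2 * om * sin th)).
  - rewrite rho_radius. field. lra.
  - symmetry. apply is_derive_unique.
    apply is_derive_ext with (fun t => flux b G (sin t)).
    + intros t. rewrite Derive_comp_sin, rho_radius by assumption. unfold flux.
      pose proof (sin2_cos2 t) as H1. unfold Rsqr in H1.
      replace (1 - sin t ^ 2) with (cos t * cos t) by (simpl; lra).
      pose proof (radius_pos b (sin t) Hb). eq_in_R. field. lra.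
    + apply (is_derive_comp (flux b G) sin); [|apply is_derive_sin].
      now apply is_derive_flux.
Qed.

Lemma smooth_C3alpha (alpha a c : R) (g : R -> R) :
  0 < alpha < 1 -> smooth everywhere g -> C3alpha alpha a c g.
Proof.
  intros Ha Hg.
  pose proof (smooth_Derive _ _ Hg) as H1. pose proof (smooth_Derive _ _ H1) as H2.
  pose proof (smooth_Derive _ _ H2) as H3. pose proof (smooth_Derive _ _ H3) as H4.
  split.
  - intros x _. repeat split; now apply (smooth_ex_derive everywhere).
  - intros a' c' _ _. destruct (Rle_lt_dec a' c') as [Hac|Hac].
    2: { exists 0. intros; lra. }
    destruct (continuous_bounded (Derive (Derive_n g 3)) a' c' Hac) as (M & HM0 & HM).
    { intros x _. apply (H4 O). exact I. }
    (* [M] bounds the fourth derivative on the compact subinterval, and y - x splits as (y - x)^(1 -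
       alpha) (y - x)^alpha. *)
    exists (M * Rpower (c' - a') (1 - alpha)). intros x y Hx Hxy Hy.
    destruct (MVT_gen (Derive_n g 3) x y (Derive (Derive_n g 3))) as (z & Hz & E).
    + intros; apply Derive_correct. now apply (smooth_ex_derive everywhere).
    + intros; apply continuity_pt_filterlim. apply (H3 O). exact I.
    + rewrite Rmin_left, Rmax_right in Hz by lra.
      rewrite Rabs_minus_sym, E, Rabs_mult, (Rabs_right (y - x)) by lra.
      rewrite Rmult_assoc.
      apply Rmult_le_compat; [apply Rabs_pos | lra | apply HM; lra |].
      rewrite <- (Rpower_1 (y - x)) at 1 by lra.
      replace 1 with (1 - alpha + alpha) at 1 by ring. rewrite Rpower_plus.
      apply Rmult_le_compat_r; [left; apply exp_pos|].
      apply Rle_Rpower_l; lra.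
Qed.

(** The derivative cos t G'(sin t) is continuous across the pole and vanishes there with the cosine.
    The filter [F] stands for either one-sided approach. *)
Lemma Derive_comp_sin_pole (G : R -> R) (x : R) (F : (R -> Prop) -> Prop) :
  smooth everywhere G -> cos x = 0 -> filter_le F (locally x) ->
  filterlim (Derive (fun t => G (sin t))) F (locally 0).
Proof.
  intros HG Hx HF.
  replace 0 with (Derive (fun t => G (sin t)) x)
    by (rewrite Derive_comp_sin, Hx by assumption; ring).
  apply (filterlim_filter_le_1 _ HF).
  apply (smooth_Derive _ _ (smooth_comp_sin G HG) O). exact I.
Qed.

Lemma axisymmetric_in_eigenspace (b lam : R) (H : R -> R) :
  0 < b < 1 -> smooth everywhere H -> regular b lam 0 H ->
  in_eigenspace b lam (fun _ t => RtoC (H (sin t))).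
Proof.
  intros Hb Hs HR. split.
  (* The height on the ellipsoid is b sin theta, hence the rescaling by 1 / b. *)
  - exists (fun _ _ z => H (/ b * z)), (fun _ _ _ => 0). split; [|split].
    + apply (smooth3_height (fun z => H (/ b * z))). intros n.
      pose proof open_everywhere.
      apply Ck_comp with everywhere; auto.
      apply Ck_mult; auto using Ck_const, Ck_id.
    + apply (smooth3_height (fun _ => 0)). intros n; apply Ck_const.
    + intros phi th _. unfold RtoC. do 2 f_equal. field. lra.
  - intros phi th Hth. unfold LapC, ReF, ImF. simpl.
    rewrite (LapR_radial b (fun t => H (sin t))), (LapR_radial b (fun _ => 0)).
    rewrite (radial_equation b lam 0), radial_Lap_0 by assumption.
    unfold Cmult, RtoC; simpl. f_equal; [|ring].
    rewrite rho_radius. pose proof (radius_pos b (sin th) Hb). field. lra.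
Qed.

(* Shifting [phi] by [PI / m] changes the sign of both modes, so that an
   axisymmetric combination of them vanishes. *)
Lemma no_axisymmetric_eigenfunction (b lam : R) (m : Z) (y1 y2 : R -> C) (f : R -> R) (th : R) :
  (m <> 0)%Z -> eigenspace_has_basis b lam m y1 y2 ->
  in_eigenspace b lam (fun _ t => RtoC (f t)) ->
  - (PI / 2) <= th <= PI / 2 -> f th = 0.
Proof.
  intros Hm [HB _] Hf Hth. apply HB in Hf. destruct Hf as (c1 & c2 & E).
  assert (Hm' : IZR m <> 0) by now apply not_0_IZR.
  pose proof (E 0 th Hth) as E0. pose proof (E (PI / IZR m) th Hth) as E1.
  unfold mode in E0, E1. rewrite opp_IZR in E0, E1.
  replace (- IZR m * (PI / IZR m)) with (- PI) in E1 by (field; auto).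
  replace (IZR m * (PI / IZR m)) with PI in E1 by (field; auto).
  rewrite !Rmult_0_r, cos_0, sin_0 in E0.
  rewrite cos_neg, sin_neg, cos_PI, sin_PI in E1.
  apply (f_equal fst) in E0. apply (f_equal fst) in E1. simpl in E0, E1. lra.
Qed.

(** Scaling by a constant commutes with the total [Derive], so both first derivatives of the
    vorticity are - lam times those of [psi]. The hypothesis covers every phi but only the open band
    in theta, hence a local argument for the latter. *)
Lemma euler_op_eigen (b om lam : R) (psi : R -> R -> C) :
  (forall phi th, - (PI / 2) < th < PI / 2 ->
     Cplus (LapC b psi phi th) (RtoC (2 * om * sin th / rho b th))
       = Cmult (RtoC (- lam)) (psi phi th)) ->
  forall phi th, - (PI / 2) < th < PI / 2 -> euler_op b om psi phi th = RtoC 0.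
Proof.
  intros H phi th Hth. unfold euler_op. cbv zeta.
  set (W := fun p t => Cplus (LapC b psi p t) (RtoC (2 * om * sin t / rho b t))).
  assert (HRe : forall p t, - (PI / 2) < t < PI / 2 -> ReF W p t = - lam * ReF psi p t).
  { intros p t Ht. unfold ReF, W. rewrite H by assumption.
    unfold Re, Cmult, RtoC; simpl. ring. }
  assert (HIm : forall p t, - (PI / 2) < t < PI / 2 -> ImF W p t = - lam * ImF psi p t).
  { intros p t Ht. unfold ImF, W. rewrite H by assumption.
    unfold Im, Cmult, RtoC; simpl. ring. }
  assert (D1 : dphiC W phi th = Cmult (RtoC (- lam)) (dphiC psi phi th)).
  { unfold dphiC, dphi.
    rewrite (Derive_ext _ (fun t => - lam * ReF psi t th)) by (intros; now apply HRe).
    rewrite (Derive_ext (fun t => ImF W t th) (fun t => - lam * ImF psi t th))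
      by (intros; now apply HIm).
    rewrite !Derive_scal. unfold Cmult, RtoC; simpl. f_equal; ring. }
  assert (D2 : dthC W phi th = Cmult (RtoC (- lam)) (dthC psi phi th)).
  { unfold dthC, dth.
    rewrite (Derive_ext_loc _ (fun t => - lam * ReF psi phi t))
      by (apply locally_interior; auto).
    rewrite (Derive_ext_loc (fun t => ImF W phi t) (fun t => - lam * ImF psi phi t))
      by (apply locally_interior; auto).
    rewrite !Derive_scal. unfold Cmult, RtoC; simpl. f_equal;
      [rewrite Rmult_0_l, Rminus_0_r | rewrite Rmult_0_l, Rplus_0_r]; reflexivity. }
  rewrite D1, D2. unfold RtoC at 3. change (0, 0) with (RtoC 0). ring.
Qed.

Theorem theorem1 (b omega alpha : R) (l : nat) (m : Z) (lam : R)
  (y1 y2 : R -> C) (Y : R -> R -> C) :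
  0 < b < 1 ->
  0 < alpha < 1 ->
  (m <> 0)%Z -> (Z.abs m <= Z.of_nat l)%Z ->
  eigenspace_has_basis b lam m y1 y2 ->
  in_eigenspace b lam Y ->
  exists g : R -> R,
    C3alpha alpha (- (PI / 2)) (PI / 2) g /\
    (forall th, - (PI / 2) < th < PI / 2 ->
       - lam * g th =
         / (cos th * rho b th) *
           Derive (fun t => cos t / rho b t * Derive g t) th
         + 2 * omega * sin th / rho b th) /\
    filterlim (Derive g) (at_left (PI / 2)) (locally 0) /\
    filterlim (Derive g) (at_right (- (PI / 2))) (locally 0) /\
    (forall phi th, - (PI / 2) < th < PI / 2 ->
       euler_op b omega (fun p t => Cplus (RtoC (g t)) (Y p t)) phi th
       = RtoC 0).
Proof.
  intros Hb Halpha Hm _ HB [HYs HYe].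
  destruct (regular_alternative b lam omega Hb) as [(G & HG & HR)|(H & HH & HR & H1)].
  2: { exfalso. assert (Hpi := PI_RGT_0).
    (* The normalisation H(1) = 1 is contradicted at the north pole. *)
    enough (H (sin (PI / 2)) = 0) by (rewrite sin_PI2 in *; lra).
    apply (no_axisymmetric_eigenfunction b lam m y1 y2 (fun t => H (sin t))); auto; [|lra].
    now apply axisymmetric_in_eigenspace. }
  set (g := fun t => G (sin t)).
  assert (Hg : smooth everywhere g) by now apply smooth_comp_sin.
  assert (Hode : forall th, - (PI / 2) < th < PI / 2 ->
    radial_Lap b g th = - lam * g th - 2 * omega * sin th / rho b th).
  { intros th Hth. now apply radial_equation. }
  exists g. split; [|split; [|split; [|split]]].
  - now apply smooth_C3alpha.
  - intros th Hth. specialize (Hode th Hth). unfold radial_Lap in Hode. lra.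
  - apply (Derive_comp_sin_pole G (PI / 2)); auto using cos_PI2.
    apply filter_le_within.
  - apply (Derive_comp_sin_pole G (- (PI / 2))); auto.
    + rewrite cos_neg; apply cos_PI2.
    + apply filter_le_within.
  - apply (euler_op_eigen b omega lam). intros phi th Hth.
    destruct (ellipsoid_meridian b Y phi HYs) as (v & w & Hv & Hw & Evw).
    specialize (HYe phi th Hth). specialize (Hode th Hth).
    pose proof (LapR_plus_radial b g v (ReF Y) phi th Hb Hg Hv
      (fun t Ht => proj1 (Evw t Ht)) Hth) as LRe.
    (* [g] is real, so the radial part added to the imaginary component is 0. *)
    pose proof (LapR_plus_radial b (fun _ => 0) w (ImF Y) phi th Hb
      (fun n => Ck_const _ n 0) Hw (fun t Ht => proj2 (Evw t Ht)) Hth) as LIm.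
    rewrite radial_Lap_0 in LIm.
    assert (YRe := f_equal fst HYe). assert (YIm := f_equal snd HYe).
    simpl in YRe, YIm.
    apply injective_projections; simpl.
    + change (LapR b (fun p t => g t + ReF Y p t) phi th + 2 * omega * sin th / rho b th
        = - lam * (g th + fst (Y phi th)) - 0 * (0 + snd (Y phi th))).
      lra.
    + change (LapR b (fun p t => 0 + ImF Y p t) phi th + 0
        = - lam * (0 + snd (Y phi th)) + 0 * (g th + fst (Y phi th))).
      lra.
Qed.
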